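(* Let $\beta\in\mathbb{C}$ with $\operatorname{Re}\beta>0$, and let $M_\beta$ denote the matrix of the operator $\mathcal{C}^\beta$ on $H^2(\mathbb{D})$ with respect to the standard orthonormal basis $(z^j)_{j=0}^\infty$. Then $$(M_\beta)_{i,j}=\begin{cases}0 & \text{if } i<j,\\[4pt] \displaystyle\binom{i}{j}\sum_{k=0}^{i-j}(-1)^k\binom{i-j}{k}(j+k+1)^{-\beta} & \text{if } i\ge j,\end{cases}$$ for all integers $i,j\ge0$.
   Context: $\mathbb{D}$ is the open unit disc and $H^2(\mathbb{D})$ is the Hardy space with orthonormal basis $(z^n)_{n\ge0}$. The Cesàro operator is the bounded operator on $H^2(\mathbb{D})$ given, for $f(z)=\sum_{k\ge0} a_k z^k$, by $\mathcal{C}f(z)=\sum_{n=0}^\infty\big(\frac{1}{n+1}\sum_{k=0}^n a_k\big)z^n$. Let $\varphi_t(z)=e^{-t}z+1-e^{-t}$, $t\ge0$, and $C_{\varphi_t}f=f\circ\varphi_t$; these form a $C_0$-semigroup on $H^2(\mathbb{D})$ with $\|C_{\varphi_t}\|=e^{t/2}$ and generator $Af(z)=(1-z)f'(z)$, and $\mathcal{C}^*=(I-A)^{-1}$, so $\mathcal{C}=(I-A^* )^{-1}$. For $\operatorname{Re}\beta>0$, the power $\mathcal{C}^\beta=(I-A^* )^{-\beta}$ is defined by $$\mathcal{C}^\beta f=\frac{1}{\Gamma(\beta)}\int_0^\infty e^{-t}\,t^{\beta-1}\,C_{\varphi_t}^*f\,dt\qquad(f\in H^2(\mathbb{D})),$$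 where $C_{\varphi_t}^*$ is the Hilbert space adjoint. The $(i,j)$ matrix entry of an operator $B$ is $\langle Bz^j,z^i\rangle$ (the coefficient of $z^i$ in $Bz^j$). For $m>0$, $m^{-\beta}=e^{-\beta\log m}$ with real $\log m$. *)

(* Defs.v *)
From Stdlib Require Import Reals Lra Lia.
From Stdlib Require Import Classical ClassicalEpsilon.
From Stdlib Require Import FunctionalExtensionality PropExtensionality.
From Coquelicot Require Import Coquelicot.

Open Scope R_scope.

(** * The Hardy space of the unit disc

    An element is represented by its sequence of Taylor coefficients at 0;
    [H2_eval] below gives the corresponding function on the disc. *)

Record H2 : Type := mkH2 {
  coef : nat -> C;
  coef_l2 : ex_series (fun n => Cmod (coef n) ^ 2)
}.

Lemma H2_ext (f g : H2) : (forall n, coef f n = coef g n) -> f = g.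
Proof.
  destruct f as [a ha], g as [b hb]; simpl; intros H.
  assert (E : a = b) by (apply functional_extensionality; exact H).
  subst b; f_equal; apply proof_irrelevance.
Qed.

Lemma l2_le (a : nat -> C) (b : nat -> R) :
  (forall n, Cmod (a n) ^ 2 <= b n) -> ex_series b ->
  ex_series (fun n => Cmod (a n) ^ 2).
Proof.
  intros H; apply @ex_series_le; intros n.
  change (norm (Cmod (a n) ^ 2)) with (Rabs (Cmod (a n) ^ 2)).
  rewrite Rabs_pos_eq; [apply H | apply pow2_ge_0].
Qed.

Lemma Cmod_plus_sq (s : R) (x y : C) : 0 < s ->
  Cmod (x + y) ^ 2 <= (1 + s) * Cmod x ^ 2 + (1 + / s) * Cmod y ^ 2.
Proof.
  intros Hs.
  assert (H := Cmod_triangle x y).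
  assert (H0 := Cmod_ge_0 (x + y)%C).
  assert (Hsq : Cmod (x + y) ^ 2 <= (Cmod x + Cmod y) ^ 2)
    by (apply pow_incr; lra).
  apply (Rle_trans _ _ _ Hsq).
  assert (E : (1 + s) * Cmod x ^ 2 + (1 + / s) * Cmod y ^ 2
              - (Cmod x + Cmod y) ^ 2 = / s * (s * Cmod x - Cmod y) ^ 2)
    by (field; lra).
  assert (0 <= / s * (s * Cmod x - Cmod y) ^ 2).
  { apply Rmult_le_pos; [left; apply Rinv_0_lt_compat; lra | apply pow2_ge_0]. }
  lra.
Qed.

Lemma ex_series_lin (a b : nat -> R) (s t : R) :
  ex_series a -> ex_series b -> ex_series (fun n => s * a n + t * b n).
Proof.
  intros Ha Hb.
  apply (ex_series_plus (fun n => s * a n) (fun n => t * b n)).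
  - exact (ex_series_scal (V := R_NormedModule) s a Ha).
  - exact (ex_series_scal (V := R_NormedModule) t b Hb).
Qed.

Lemma H2_plus_l2 (f g : H2) :
  ex_series (fun n => Cmod (coef f n + coef g n) ^ 2).
Proof.
  apply (l2_le _ (fun n => (1 + 1) * Cmod (coef f n) ^ 2
                           + (1 + / 1) * Cmod (coef g n) ^ 2)).
  - intros n; apply Cmod_plus_sq; lra.
  - apply ex_series_lin; apply coef_l2.
Qed.

Lemma H2_scal_l2 (c : C) (f : H2) :
  ex_series (fun n => Cmod (c * coef f n) ^ 2).
Proof.
  apply (l2_le _ (fun n => Cmod c ^ 2 * Cmod (coef f n) ^ 2)).
  - intros n; rewrite Cmod_mult, Rpow_mult_distr; apply Rle_refl.
  - exact (ex_series_scal (V := R_NormedModule) _ _ (coef_l2 f)).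
Qed.

Lemma finite_l2 (a : nat -> C) (N : nat) :
  (forall n, (N <= n)%nat -> a n = RtoC 0) -> ex_series (fun n => Cmod (a n) ^ 2).
Proof.
  intros H; apply (ex_series_incr_n _ N).
  apply (ex_series_ext (fun _ => 0)).
  - intros n; rewrite H by lia; rewrite Cmod_0; simpl; ring.
  - exists 0; apply (filterlim_ext (fun _ => 0)).
    + intros n; rewrite sum_n_const; simpl; ring.
    + apply filterlim_const.
Qed.

Lemma monomial_finite (j n : nat) : (S j <= n)%nat ->
  (if Nat.eqb n j then RtoC 1 else RtoC 0) = RtoC 0.
Proof.
  intros H; destruct (Nat.eqb_spec n j); [lia | reflexivity].
Qed.

(** The function z^j. *)
Definition H2_monomial (j : nat) : H2 :=
  mkH2 (fun n => if Nat.eqb n j then RtoC 1 else RtoC 0)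
       (finite_l2 _ (S j) (monomial_finite j)).

Definition H2_zero : H2 :=
  mkH2 (fun _ => RtoC 0) (finite_l2 _ 0 (fun _ _ => eq_refl)).
Definition H2_plus (f g : H2) : H2 :=
  mkH2 (fun n => coef f n + coef g n)%C (H2_plus_l2 f g).
Definition H2_scal (c : C) (f : H2) : H2 :=
  mkH2 (fun n => c * coef f n)%C (H2_scal_l2 c f).
Definition H2_opp (f : H2) : H2 := H2_scal (- RtoC 1)%C f.

(** Linear in the first variable. *)
Definition H2_inner (f g : H2) : C :=
  iota (T := C_CompleteNormedModule)
    (is_series (fun n => coef f n * Cconj (coef g n))%C).

Definition H2_norm (f : H2) : R := sqrt (Series (fun n => Cmod (coef f n) ^ 2)).

Definition H2_eval (f : H2) (z : C) : C :=
  iota (T := C_CompleteNormedModule) (is_pseries (coef f) z).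

(** ** Banach space structure

    Coquelicot integrates functions of a real variable with values in a
    complete normed module over R, so the canonical structures on [H2] are the
    real ones; multiplication by complex scalars is [H2_scal]. *)

Lemma Series_sq_pos (f : H2) : 0 <= Series (fun n => Cmod (coef f n) ^ 2).
Proof.
  rewrite <- (Rmult_0_l (Series (fun n => Cmod (coef f n) ^ 2))) at 1.
  rewrite <- Series_scal_l.
  apply Series_le; [ | apply coef_l2].
  intros n; assert (H := pow2_ge_0 (Cmod (coef f n))); lra.
Qed.

Lemma H2_norm_pos (f : H2) : 0 <= H2_norm f.
Proof. apply sqrt_pos. Qed.

Lemma H2_norm_sq (f : H2) :
  H2_norm f ^ 2 = Series (fun n => Cmod (coef f n) ^ 2).
Proof. apply pow2_sqrt, Series_sq_pos. Qed.

Lemma sum_sq_le_norm (f : H2) (N : nat) :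
  sum_n (fun n => Cmod (coef f n) ^ 2) N <= H2_norm f ^ 2.
Proof.
  rewrite H2_norm_sq.
  assert (Hl := Series_correct _ (coef_l2 f)).
  refine (is_lim_seq_incr_compare _ _ Hl _ N).
  intros n; rewrite sum_Sn; unfold plus; simpl.
  assert (H := pow2_ge_0 (Cmod (coef f (S n)))); simpl in H; lra.
Qed.

Lemma coef_le_norm (f : H2) (n : nat) : Cmod (coef f n) <= H2_norm f.
Proof.
  assert (H : Cmod (coef f n) ^ 2 <= H2_norm f ^ 2).
  { refine (Rle_trans _ _ _ _ (sum_sq_le_norm f n)).
    destruct n as [ | n].
    - rewrite sum_O; apply Rle_refl.
    - rewrite sum_Sn; unfold plus; simpl.
      assert (H : 0 <= sum_n (fun n => Cmod (coef f n) ^ 2) n).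
      { rewrite <- (Rmult_0_r (INR (S n))), <- sum_n_const.
        apply sum_n_m_le; intros k; apply pow2_ge_0. }
      simpl in H; lra. }
  assert (H1 := Cmod_ge_0 (coef f n)); assert (H2' := H2_norm_pos f).
  apply Rnot_lt_le; intros H3.
  assert (H2_norm f ^ 2 < Cmod (coef f n) ^ 2) by (simpl; nra); lra.
Qed.

Lemma norm_le_of_sums (f : H2) (r : R) : 0 <= r ->
  (forall N, sum_n (fun n => Cmod (coef f n) ^ 2) N <= r ^ 2) ->
  H2_norm f <= r.
Proof.
  intros Hr H.
  rewrite <- (sqrt_pow2 r Hr); apply sqrt_le_1_alt.
  assert (Hl := Series_correct _ (coef_l2 f)).
  refine (is_lim_seq_le _ _ (Finite _) (Finite _) H Hl (is_lim_seq_const _)).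
Qed.

Lemma H2_norm_eq_0 (f : H2) : H2_norm f = 0 -> f = H2_zero.
Proof.
  intros H; apply H2_ext; intros n; simpl.
  apply Cmod_eq_0; assert (H1 := coef_le_norm f n).
  assert (H2' := Cmod_ge_0 (coef f n)); lra.
Qed.

Lemma H2_norm_scal (c : C) (f : H2) : H2_norm (H2_scal c f) = Cmod c * H2_norm f.
Proof.
  unfold H2_norm.
  rewrite (Series_ext _ (fun n => Cmod c ^ 2 * Cmod (coef f n) ^ 2)).
  - rewrite Series_scal_l, sqrt_mult_alt by apply pow2_ge_0.
    rewrite sqrt_pow2 by apply Cmod_ge_0; reflexivity.
  - intros n; simpl coef; rewrite Cmod_mult, Rpow_mult_distr; reflexivity.
Qed.

Lemma H2_plus_0_l (f : H2) : H2_plus H2_zero f = f.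
Proof. apply H2_ext; intros n; simpl; ring. Qed.

Lemma H2_plus_0_r (f : H2) : H2_plus f H2_zero = f.
Proof. apply H2_ext; intros n; simpl; ring. Qed.

Lemma H2_norm_triangle (f g : H2) :
  H2_norm (H2_plus f g) <= H2_norm f + H2_norm g.
Proof.
  assert (Hf := H2_norm_pos f); assert (Hg := H2_norm_pos g).
  destruct Hf as [Hf | Hf].
  2:{ rewrite (H2_norm_eq_0 f (eq_sym Hf)) at 1.
      rewrite H2_plus_0_l; lra. }
  destruct Hg as [Hg | Hg].
  2:{ rewrite (H2_norm_eq_0 g (eq_sym Hg)) at 1.
      rewrite H2_plus_0_r; lra. }
  set (s := H2_norm g / H2_norm f).
  assert (Hs : 0 < s) by (apply Rdiv_lt_0_compat; assumption).
  rewrite <- (sqrt_pow2 (H2_norm f + H2_norm g)) by lra.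
  apply sqrt_le_1_alt.
  replace ((H2_norm f + H2_norm g) ^ 2)
    with ((1 + s) * H2_norm f ^ 2 + (1 + / s) * H2_norm g ^ 2)
    by (unfold s; field; lra).
  rewrite !H2_norm_sq.
  assert (Hex1 := ex_series_scal (V := R_NormedModule) (1 + s) _ (coef_l2 f)).
  assert (Hex2 := ex_series_scal (V := R_NormedModule) (1 + / s) _ (coef_l2 g)).
  rewrite <- !Series_scal_l, <- Series_plus by assumption.
  apply Series_le.
  - intros n; split; [apply pow2_ge_0 | apply Cmod_plus_sq, Hs].
  - apply (ex_series_plus (V := R_NormedModule) _ _ Hex1 Hex2).
Qed.

Lemma H2_plus_comm (f g : H2) : H2_plus f g = H2_plus g f.
Proof. apply H2_ext; intros n; simpl; ring. Qed.
Lemma H2_plus_assoc (f g h : H2) :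
  H2_plus f (H2_plus g h) = H2_plus (H2_plus f g) h.
Proof. apply H2_ext; intros n; simpl; ring. Qed.
Lemma H2_plus_opp (f : H2) : H2_plus f (H2_opp f) = H2_zero.
Proof. apply H2_ext; intros n; simpl; ring. Qed.
Lemma H2_scal_assoc (x y : C) (f : H2) :
  H2_scal x (H2_scal y f) = H2_scal (x * y)%C f.
Proof. apply H2_ext; intros n; simpl; ring. Qed.
Lemma H2_scal_1 (f : H2) : H2_scal (RtoC 1) f = f.
Proof. apply H2_ext; intros n; simpl; ring. Qed.
Lemma H2_scal_plus_r (x : C) (f g : H2) :
  H2_scal x (H2_plus f g) = H2_plus (H2_scal x f) (H2_scal x g).
Proof. apply H2_ext; intros n; simpl; ring. Qed.
Lemma H2_scal_plus_l (x y : C) (f : H2) :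
  H2_scal (x + y)%C f = H2_plus (H2_scal x f) (H2_scal y f).
Proof. apply H2_ext; intros n; simpl; ring. Qed.

Definition H2_AbelianMonoid_mixin :=
  AbelianMonoid.Mixin H2 H2_plus H2_zero H2_plus_comm H2_plus_assoc H2_plus_0_r.
Canonical H2_AbelianMonoid := AbelianMonoid.Pack H2 H2_AbelianMonoid_mixin H2.

Definition H2_AbelianGroup_mixin :=
  AbelianGroup.Mixin H2_AbelianMonoid H2_opp H2_plus_opp.
Canonical H2_AbelianGroup :=
  AbelianGroup.Pack H2 (AbelianGroup.Class _ _ H2_AbelianGroup_mixin) H2.

Definition H2_R_scal (x : R) (f : H2) : H2 := H2_scal (RtoC x) f.

Lemma H2_R_scal_assoc (x y : R) (f : H2) :
  H2_R_scal x (H2_R_scal y f) = H2_R_scal (x * y) f.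
Proof. unfold H2_R_scal; rewrite H2_scal_assoc, RtoC_mult; reflexivity. Qed.
Lemma H2_R_scal_plus_l (x y : R) (f : H2) :
  H2_R_scal (x + y) f = H2_plus (H2_R_scal x f) (H2_R_scal y f).
Proof. unfold H2_R_scal; rewrite RtoC_plus; apply H2_scal_plus_l. Qed.

Definition H2_ModuleSpace_mixin :=
  ModuleSpace.Mixin R_Ring H2_AbelianGroup H2_R_scal H2_R_scal_assoc H2_scal_1
    (fun x => H2_scal_plus_r (RtoC x)) H2_R_scal_plus_l.
Canonical H2_ModuleSpace :=
  ModuleSpace.Pack R_Ring H2 (ModuleSpace.Class _ _ _ H2_ModuleSpace_mixin) H2.

Definition H2_ball (f : H2) (eps : R) (g : H2) : Prop :=
  H2_norm (minus g f) < eps.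

Lemma H2_ball_center (f : H2) (eps : posreal) : H2_ball f eps f.
Proof.
  unfold H2_ball.
  replace (minus f f) with (H2_scal (RtoC 0) f).
  - rewrite H2_norm_scal, Cmod_0, Rmult_0_l; apply cond_pos.
  - rewrite minus_eq_zero; apply H2_ext; intros n; simpl; ring.
Qed.

Lemma H2_ball_sym (f g : H2) (eps : R) : H2_ball f eps g -> H2_ball g eps f.
Proof.
  unfold H2_ball; intros H.
  replace (minus f g) with (H2_scal (- RtoC 1)%C (minus g f)).
  - rewrite H2_norm_scal, Cmod_m1, Rmult_1_l; exact H.
  - rewrite <- (opp_minus g f); reflexivity.
Qed.

Lemma H2_ball_triangle (f g h : H2) (e1 e2 : R) :
  H2_ball f e1 g -> H2_ball g e2 h -> H2_ball f (e1 + e2) h.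
Proof.
  unfold H2_ball; intros H1 H2'.
  rewrite (minus_trans g h f).
  eapply Rle_lt_trans; [apply H2_norm_triangle | lra].
Qed.

Definition H2_UniformSpace_mixin :=
  UniformSpace.Mixin H2 H2_zero H2_ball H2_ball_center H2_ball_sym
    H2_ball_triangle.
Canonical H2_UniformSpace := UniformSpace.Pack H2 H2_UniformSpace_mixin H2.

Canonical H2_NormedModuleAux :=
  NormedModuleAux.Pack R_AbsRing H2
    (NormedModuleAux.Class R_AbsRing H2 (ModuleSpace.class _ H2_ModuleSpace)
       (UniformSpace.class H2_UniformSpace)) H2.

Lemma H2_R_norm_scal (x : R) (f : H2) :
  H2_norm (H2_R_scal x f) <= Rabs x * H2_norm f.
Proof. unfold H2_R_scal; rewrite H2_norm_scal, Cmod_R; apply Rle_refl. Qed.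

Lemma H2_ball_norm (f g : H2) (eps : posreal) :
  H2_ball f eps g -> H2_norm (minus g f) < 1 * eps.
Proof. unfold H2_ball; lra. Qed.

Definition H2_NormedModule_mixin :=
  NormedModule.Mixin R_AbsRing H2_NormedModuleAux H2_norm 1 H2_norm_triangle
    H2_R_norm_scal (fun _ _ _ H => H) H2_ball_norm H2_norm_eq_0.
Canonical H2_NormedModule :=
  NormedModule.Pack R_AbsRing H2
    (NormedModule.Class _ _ _ H2_NormedModule_mixin) H2.

Lemma coef_minus (f g : H2) (n : nat) :
  coef (minus f g) n = (coef f n - coef g n)%C.
Proof. unfold minus, opp; simpl; ring. Qed.

Lemma Cmod_lt_ball (x y : C) (e : R) : Cmod (y - x) < e -> ball x e y.
Proof. apply C_NormedModule_mixin_compat1. Qed.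

Lemma coef_lim (F : (H2 -> Prop) -> Prop) : ProperFilter F -> cauchy F ->
  exists x : nat -> C,
    forall n (eps : posreal), F (fun f => Cmod (coef f n - x n) < eps).
Proof.
  intros HF HC.
  pose (G n := filtermap (fun f : H2 => coef f n) F).
  exists (fun n => lim (T := C_CompleteNormedModule) (G n)).
  intros n eps.
  assert (HG : ProperFilter (G n)) by (apply filtermap_proper_filter, HF).
  assert (Hc : cauchy (T := C_UniformSpace) (G n)).
  { intros e; destruct (HC e) as [f Hf]; exists (coef f n).
    change (F (fun g => ball (M := C_UniformSpace) (coef f n) e (coef g n))).
    revert Hf; apply filter_imp; intros g Hg.
    apply Cmod_lt_ball; rewrite <- coef_minus.
    exact (Rle_lt_trans _ _ _ (coef_le_norm _ _) Hg). }
  assert (He : 0 < eps / 2) by (assert (H := cond_pos eps); lra).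
  assert (H := complete_cauchy (T := C_CompleteNormedModule) (G n) HG Hc
                 (mkposreal _ He)).
  change (F (fun f => ball (M := C_UniformSpace)
                        (lim (T := C_CompleteNormedModule) (G n)) (eps / 2)
                        (coef f n))) in H.
  revert H; apply filter_imp; intros f Hf.
  apply (C_NormedModule_mixin_compat2 _ _ (mkposreal _ He)) in Hf; simpl in Hf.
  assert (Hs : sqrt 2 <= 2).
  { rewrite <- (sqrt_pow2 2) at 2 by lra; apply sqrt_le_1_alt; lra. }
  eapply Rlt_le_trans; [exact Hf | nra].
Qed.

Lemma l2_of_bounded (a : nat -> C) (M : R) :
  (forall N, sum_n (fun n => Cmod (a n) ^ 2) N <= M) ->
  ex_series (fun n => Cmod (a n) ^ 2).
Proof.
  intros H.
  destruct (ex_finite_lim_seq_incr (sum_n (fun n => Cmod (a n) ^ 2)) M) as [l Hl].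
  - intros n; rewrite sum_Sn; unfold plus; simpl.
    assert (H1 := pow2_ge_0 (Cmod (a (S n)))); simpl in H1; lra.
  - exact H.
  - exists l; exact Hl.
Qed.

Lemma sum_sq_near (F : (H2 -> Prop) -> Prop) (x : nat -> C) (y : H2) (N : nat) :
  ProperFilter F ->
  (forall n (eps : posreal), F (fun f => Cmod (coef f n - x n) < eps)) ->
  forall eps : posreal,
  F (fun f => sum_n (fun n => Cmod (x n - coef y n) ^ 2) N
              <= 2 * sum_n (fun n => Cmod (coef f n - coef y n) ^ 2) N + eps).
Proof.
  intros HF Hx; induction N as [ | N IH]; intros eps.
  - assert (He : 0 < Rmin 1 (eps / 2)).
    { apply Rmin_pos; [lra | assert (H := cond_pos eps); lra]. }
    generalize (Hx 0%nat (mkposreal _ He)); apply filter_imp; intros f Hf.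
    rewrite !sum_O; simpl in Hf.
    replace (x 0%nat - coef y 0)%C
      with ((coef f 0 - coef y 0) + - (coef f 0 - x 0%nat))%C by ring.
    eapply Rle_trans; [apply (Cmod_plus_sq 1); lra | ].
    rewrite Cmod_opp, Rinv_1.
    assert (H0 := Cmod_ge_0 (coef f 0 - x 0%nat)%C).
    assert (H1 := Rmin_l 1 (eps / 2)); assert (H2' := Rmin_r 1 (eps / 2)).
    assert (Cmod (coef f 0 - x 0%nat) ^ 2 <= eps / 2) by nra.
    lra.
  - assert (He0 : 0 < eps / 2) by (assert (H := cond_pos eps); lra).
    assert (He : 0 < Rmin 1 (eps / 2 / 2)) by (apply Rmin_pos; lra).
    generalize (filter_and _ _ (IH (mkposreal _ He0))
                  (Hx (S N) (mkposreal _ He))).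
    apply filter_imp; intros f [Hf1 Hf]; simpl pos in *.
    rewrite !sum_Sn; unfold plus; simpl AbelianMonoid.plus.
    set (u := coef y (S N)) in *.
    assert (Cmod (x (S N) - u) ^ 2
            <= 2 * Cmod (coef f (S N) - u) ^ 2 + eps / 2).
    { replace (x (S N) - u)%C
        with ((coef f (S N) - u) + - (coef f (S N) - x (S N)))%C by ring.
      eapply Rle_trans; [apply (Cmod_plus_sq 1); lra | ].
      rewrite Cmod_opp, Rinv_1.
      assert (H0 := Cmod_ge_0 (coef f (S N) - x (S N))%C).
      assert (H1 := Rmin_l 1 (eps / 2 / 2)).
      assert (H2' := Rmin_r 1 (eps / 2 / 2)).
      assert (Cmod (coef f (S N) - x (S N)) ^ 2 <= eps / 2 / 2) by nra.
      lra. }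
    simpl in *; lra.
Qed.

Lemma H2_complete (F : (H2 -> Prop) -> Prop) : ProperFilter F -> cauchy F ->
  exists f : H2, forall eps : posreal, F (ball f eps).
Proof.
  intros HF HC.
  destruct (coef_lim F HF HC) as [x Hx].
  assert (Key : forall (y : H2) (d : posreal), F (ball y d) ->
    forall N, sum_n (fun n => Cmod (x n - coef y n) ^ 2) N <= (2 * d) ^ 2).
  { intros y d Hy N.
    assert (Hd := cond_pos d).
    assert (He : 0 < 2 * d ^ 2) by nra.
    destruct (filter_ex _ (filter_and _ _ Hy
      (sum_sq_near F x y N HF Hx (mkposreal _ He)))) as [f [Hf1 Hf2]].
    simpl pos in Hf2; eapply Rle_trans; [exact Hf2 | ].
    assert (H := sum_sq_le_norm (minus f y) N).
    rewrite (sum_n_ext _ (fun n => Cmod (coef f n - coef y n) ^ 2)) in H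
      by (intros n; rewrite coef_minus; reflexivity).
    assert (H1 : H2_norm (minus f y) < d) by exact Hf1.
    assert (H2' := H2_norm_pos (minus f y)).
    assert (H2_norm (minus f y) ^ 2 <= d ^ 2) by (apply pow_incr; lra).
    eapply Rle_trans;
      [apply Rplus_le_compat_r, Rmult_le_compat_l, H; lra | nra]. }
  destruct (HC (mkposreal 1 Rlt_0_1)) as [y0 Hy0].
  set (g := mkH2 _ (l2_of_bounded (fun n => x n - coef y0 n)%C _ (Key _ _ Hy0))).
  exists (plus g y0); intros eps.
  assert (He : 0 < eps / 4) by (assert (H := cond_pos eps); lra).
  destruct (HC (mkposreal _ He)) as [y Hy].
  assert (Hn : H2_norm (minus (plus g y0) y) <= 2 * (eps / 4)).
  { apply norm_le_of_sums; [lra | intros N].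
    eapply Rle_trans; [ | exact (Key _ _ Hy N)].
    right; apply sum_n_ext; intros n.
    replace (coef (minus (plus g y0) y) n) with (x n - coef y n)%C;
      [reflexivity | rewrite coef_minus; simpl; ring]. }
  revert Hy; apply filter_imp; intros f Hf.
  change (H2_ball (plus g y0) eps f).
  replace (pos eps) with ((3 / 4 * eps) + eps / 4) by field.
  apply (H2_ball_triangle _ y); [ | exact Hf].
  apply H2_ball_sym; unfold H2_ball.
  assert (H := cond_pos eps); lra.
Qed.

Definition H2_lim (F : (H2 -> Prop) -> Prop) : H2 :=
  epsilon (inhabits H2_zero) (fun f => forall eps : posreal, F (ball f eps)).

Lemma H2_lim_correct (F : (H2 -> Prop) -> Prop) : ProperFilter F -> cauchy F ->
  forall eps : posreal, F (ball (H2_lim F) eps).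
Proof.
  intros HF HC.
  exact (epsilon_spec (inhabits H2_zero) _ (H2_complete F HF HC)).
Qed.

Lemma H2_lim_ext (F1 F2 : (H2 -> Prop) -> Prop) :
  filter_le F1 F2 -> filter_le F2 F1 -> close (H2_lim F1) (H2_lim F2).
Proof.
  intros H1 H2'.
  assert (E : F1 = F2).
  { apply functional_extensionality; intros P.
    apply propositional_extensionality; split; [apply H2' | apply H1]. }
  rewrite E; apply close_refl.
Qed.

Definition H2_CompleteSpace_mixin :=
  CompleteSpace.Mixin H2_UniformSpace H2_lim H2_lim_correct H2_lim_ext.
Canonical H2_CompleteSpace :=
  CompleteSpace.Pack H2 (CompleteSpace.Class _ _ H2_CompleteSpace_mixin) H2.
Canonical H2_CompleteNormedModule :=
  CompleteNormedModule.Pack R_AbsRing H2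
    (CompleteNormedModule.Class R_AbsRing H2
       (NormedModule.class _ H2_NormedModule) H2_CompleteSpace_mixin) H2.

(** * Operators on the Hardy space *)

(** [iota] is Coquelicot's definite description: it is the unique element
    satisfying the predicate when there is one, and unspecified otherwise. *)

(** f |-> f o phi, for phi a self-map of the disc. *)
Definition composition_op (phi : C -> C) (f : H2) : H2 :=
  iota (fun g : H2 =>
    forall z : C, Cmod z < 1 -> H2_eval g z = H2_eval f (phi z)).

Definition adjoint (T : H2 -> H2) (g : H2) : H2 :=
  iota (fun h : H2 => forall f : H2, H2_inner (T f) g = H2_inner f h).

Definition matrix_entry (B : H2 -> H2) (i j : nat) : C :=
  H2_inner (B (H2_monomial j)) (H2_monomial i).

(** * Powers of the Cesàro operator *)

Definition Cexp (z : C) : C := (exp (Re z) * cos (Im z), exp (Re z) * sin (Im z)).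

(** x^s with the real logarithm; meaningful for 0 < x only. *)
Definition Rcpow (x : R) (s : C) : C := Cexp (s * RtoC (ln x)).

(** Euler's integral, for 0 < Re s. *)
Definition Cgamma (s : C) : C :=
  RInt_gen (V := C_R_CompleteNormedModule)
    (fun t => RtoC (exp (- t)) * Rcpow t (s - 1))%C
    (at_right 0) (Rbar_locally p_infty).

Definition phi (t : R) (z : C) : C :=
  (RtoC (exp (- t)) * z + 1 - RtoC (exp (- t)))%C.

(** (I - A^* )^(-beta), where A is the generator of the semigroup
    [composition_op (phi t)]; here 0 < Re beta. The integral is a
    norm-convergent improper Riemann integral in [H2]. *)
Definition Cesaro_pow (beta : C) (f : H2) : H2 :=
  H2_scal (/ Cgamma beta)
    (RInt_gen
       (fun t => H2_scal (RtoC (exp (- t)) * Rcpow t (beta - 1))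
                   (adjoint (composition_op (phi t)) f))
       (at_right 0) (Rbar_locally p_infty)).

(* Main.v *)
Require Import Defs.
From Stdlib Require Import Reals Lra Lia Psatz.
From Coquelicot Require Import Coquelicot.
Open Scope R_scope.

(** The matrix of [f |-> f o phi_t] is that of the binomial distribution: with
    [p = exp (- t)], the coefficient of [z^j] in [(p z + 1 - p)^n] is
    [C(n,j) p^j (1 - p)^(n - j)]. Schur's test shows that this matrix acts
    boundedly on l^2, with norm at most [exp (t / 2)], so the composition
    operator exists, and the coefficients of the adjoint applied to [z^j] are the
    [j]-th row of the matrix. The integrand of [C^beta z^j] is therefore
    norm-continuous and dominated by [exp (- t / 2) t^(Re beta - 1)], so that
    coefficients may be taken under the integral. Expanding [(1 - exp (- t))^(i - j)]
    reduces the entry to [int_0^oo exp (- m t) t^(beta - 1) dt = m^(- beta) Gamma(beta)].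
    Dividing by [Gamma(beta)] requires that Gamma has no zero in the right
    half-plane. *)

(** * Binomial weights *)

(** [composition_op], [adjoint] and the improper integrals are definite descriptions, so each says
    nothing until existence and uniqueness are established; this shapes the whole proof. The adjoint
    is evaluated only at [z^j], where the representing vector can be written down explicitly, so
    that the Riesz representation theorem is avoided. The integral with values in [H2] has to be
    shown convergent in norm before any coefficient is taken; this comes from Cauchy's criterion in
    the complete space [H2]. The rate [exp (- t / 2)] is what remains of [exp (- t)] once the norm
    [exp (t / 2)] is paid for, and one majorant serves both this integral and Euler's. The
    nonvanishing of Gamma uses neither a product nor a reflection formula, only the functional
    equation, positivity of Gamma at real arguments, and elementary bounds on [cos] and [ln]. *)

Lemma sum_n_shift {G : AbelianMonoid} (a : nat -> G) (n : nat) :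
  sum_n a (S n) = plus (a 0%nat) (sum_n (fun k => a (S k)) n).
Proof.
  unfold sum_n; rewrite sum_Sn_m by lia; f_equal.
  symmetry; apply (sum_n_m_S a 0 n).
Qed.

Lemma sum_n_le_incr (a : nat -> R) (n m : nat) :
  (forall k, 0 <= a k) -> (n <= m)%nat -> sum_n a n <= sum_n a m.
Proof.
  intros Ha; induction 1 as [ | m _ IH]; [lra | ].
  rewrite sum_Sn; unfold plus; simpl; specialize (Ha (S m)); lra.
Qed.

Lemma sum_n_ge_0 (a : nat -> R) (n : nat) :
  (forall k, 0 <= a k) -> 0 <= sum_n a n.
Proof.
  intros Ha; apply Rle_trans with (sum_n a 0); [rewrite sum_O; apply Ha | ].
  apply sum_n_le_incr; [exact Ha | lia].
Qed.

Lemma sum_n_Rplus (a b : nat -> R) (n : nat) :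
  sum_n (fun k => a k + b k) n = sum_n a n + sum_n b n.
Proof. exact (sum_n_plus (G := R_AbelianMonoid) a b n). Qed.

Lemma sum_n_Rmult (c : R) (a : nat -> R) (n : nat) :
  sum_n (fun k => c * a k) n = c * sum_n a n.
Proof. exact (sum_n_mult_l (K := R_Ring) c a n). Qed.

Lemma sum_n_Rshift (a : nat -> R) (n : nat) :
  sum_n a (S n) = a 0%nat + sum_n (fun k => a (S k)) n.
Proof. exact (sum_n_shift a n). Qed.

Lemma sum_n_RS (a : nat -> R) (n : nat) :
  sum_n a (S n) = sum_n a n + a (S n).
Proof. exact (sum_Sn a n). Qed.

Lemma sum_n_Rle (a b : nat -> R) (n : nat) :
  (forall k, a k <= b k) -> sum_n a n <= sum_n b n.
Proof. intros H; apply sum_n_m_le, H. Qed.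

Lemma Cmod_sum_n (a : nat -> C) (n : nat) :
  Cmod (sum_n a n) <= sum_n (fun k => Cmod (a k)) n.
Proof. exact (norm_sum_n_m (V := C_NormedModule) a 0 n). Qed.

Lemma ex_series_bounded (a : nat -> R) (M : R) :
  (forall n, 0 <= a n) -> (forall n, sum_n a n <= M) -> ex_series a.
Proof.
  intros Ha HM.
  destruct (ex_finite_lim_seq_incr (sum_n a) M) as [l Hl].
  - intros n; apply sum_n_le_incr; [exact Ha | lia].
  - exact HM.
  - exists l; exact Hl.
Qed.

Lemma weighted_cauchy_schwarz (w a : nat -> R) (n : nat) :
  (forall k, 0 <= w k) -> (forall k, 0 <= a k) ->
  (sum_n (fun k => w k * a k) n) ^ 2
  <= sum_n w n * sum_n (fun k => w k * a k ^ 2) n.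
Proof.
  intros Hw Ha; induction n as [ | n IH].
  - rewrite !sum_O; apply Req_le; ring.
  - rewrite !sum_n_RS.
    set (x := sum_n (fun k => w k * a k) n) in *.
    set (y := sum_n w n) in *.
    set (z := sum_n (fun k => w k * a k ^ 2) n) in *.
    assert (Hx : 0 <= x)
      by (apply sum_n_ge_0; intros k; apply Rmult_le_pos; auto).
    assert (Hy : 0 <= y) by (apply sum_n_ge_0; auto).
    assert (Hz : 0 <= z).
    { apply sum_n_ge_0; intros k; apply Rmult_le_pos; [auto | apply pow2_ge_0]. }
    generalize (Hw (S n)) (Ha (S n)).
    generalize (w (S n)) (a (S n)); intros v b Hv Hb.
    (* The cross term of the square, by the arithmetic-geometric mean:
       [(y b^2 + z)^2 >= 4 y z b^2 >= 4 x^2 b^2], the last step being the induction hypothesis. *)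
    assert (2 * (x * b) <= y * b ^ 2 + z).
    { apply Rsqr_incr_0_var; unfold Rsqr; [ | nra].
      assert (0 <= (y * b ^ 2 - z) ^ 2) by apply pow2_ge_0.
      assert (x ^ 2 * b ^ 2 <= (y * z) * b ^ 2)
        by (apply Rmult_le_compat_r; [apply pow2_ge_0 | exact IH]).
      nra. }
    nra.
Qed.

(** The coefficient of [z^j] in [(p z + 1 - p)^n]. The recursion is Pascal's rule,
    which makes [binom_weight p n j] vanish for [n < j], unlike [Binomial.C n j]. *)
Fixpoint binom_weight (p : R) (n j : nat) : R :=
  match n, j with
  | O, O => 1
  | O, S _ => 0
  | S n', O => (1 - p) * binom_weight p n' 0
  | S n', S j' => p * binom_weight p n' j' + (1 - p) * binom_weight p n' (S j')
  end.

Lemma binom_weight_ge_0 (p : R) (n j : nat) :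
  0 <= p <= 1 -> 0 <= binom_weight p n j.
Proof.
  intros Hp; revert j; induction n as [ | n IH]; intros [ | j]; simpl; try lra.
  - apply Rmult_le_pos; [lra | apply IH].
  - assert (H1 := IH j); assert (H2 := IH (S j)); nra.
Qed.

Lemma binom_weight_gt (p : R) (n j : nat) : (n < j)%nat -> binom_weight p n j = 0.
Proof.
  revert j; induction n as [ | n IH]; intros [ | j] H; simpl; try lia; auto.
  rewrite !IH by lia; ring.
Qed.

Lemma binomial_C_n_0 (n : nat) : Binomial.C n 0 = 1.
Proof.
  unfold Binomial.C; rewrite Nat.sub_0_r; simpl; field; apply INR_fact_neq_0.
Qed.

Lemma binomial_C_n_n (n : nat) : Binomial.C n n = 1.
Proof.
  unfold Binomial.C; rewrite Nat.sub_diag; simpl; field; apply INR_fact_neq_0.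
Qed.

Lemma binom_weight_closed (p : R) (n j : nat) : (j <= n)%nat ->
  binom_weight p n j = Binomial.C n j * p ^ j * (1 - p) ^ (n - j).
Proof.
  revert j; induction n as [ | n IH]; intros j Hj.
  - replace j with 0%nat by lia; rewrite binomial_C_n_0; simpl; ring.
  - destruct j as [ | j].
    + simpl binom_weight; rewrite IH, !binomial_C_n_0, Nat.sub_0_r by lia.
      rewrite Nat.sub_0_r; simpl; ring.
    + simpl binom_weight; rewrite (IH j) by lia.
      destruct (Nat.eq_dec j n) as [-> | Hne].
      * rewrite (binom_weight_gt p n (S n)), !binomial_C_n_n, !Nat.sub_diag by lia.
        simpl; ring.
      * rewrite (IH (S j)), <- pascal by lia.
        replace (S n - S j)%nat with (n - j)%nat by lia.
        replace (n - j)%nat with (S (n - S j)) by lia; simpl; ring.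
Qed.

(** An inequality, because [J] may cut the expansion short. At [x = 1] it yields the column sums; at
    [x = Cmod z] it yields a majorant uniform in [J] for the double series of [f o phi_t]. *)
Lemma binom_weight_genfun_le (p x : R) (n J : nat) : 0 <= p <= 1 -> 0 <= x ->
  sum_n (fun j => binom_weight p n j * x ^ j) J <= (p * x + (1 - p)) ^ n.
Proof.
  intros Hp Hx; revert J; induction n as [ | n IH]; intros J.
  - destruct J as [ | J]; [rewrite sum_O; simpl; lra | ].
    rewrite sum_n_Rshift; simpl.
    rewrite (sum_n_ext _ (fun k => 0 * INR k)) by (intros k; simpl; ring).
    rewrite sum_n_Rmult; lra.
  - assert (Hr : 0 <= p * x) by nra.
    destruct J as [ | J].
    + assert (H := IH 0%nat); rewrite sum_O in H |- *; simpl in H |- *.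
      assert (H0 := binom_weight_ge_0 p n 0 Hp); nra.
    + rewrite sum_n_Rshift.
      assert (H1 := IH J); assert (H2 := IH (S J)).
      rewrite sum_n_Rshift in H2.
      rewrite (sum_n_ext _ (fun k => p * x * (binom_weight p n k * x ^ k)
                 + (1 - p) * (binom_weight p n (S k) * x ^ S k)))
        by (intros k; simpl; ring).
      rewrite sum_n_Rplus, !sum_n_Rmult.
      set (u := sum_n (fun k => binom_weight p n k * x ^ k) J) in *.
      set (v := sum_n (fun k => binom_weight p n (S k) * x ^ S k) J) in *.
      simpl; simpl in H2; nra.
Qed.

Lemma binom_weight_col_sum (p : R) (n J : nat) : 0 <= p <= 1 ->
  sum_n (binom_weight p n) J <= 1.
Proof.
  intros Hp; assert (H := binom_weight_genfun_le p 1 n J Hp Rle_0_1).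
  replace (p * 1 + (1 - p)) with 1 in H by ring; rewrite pow1 in H.
  erewrite sum_n_ext; [exact H | intros j; simpl; rewrite pow1; ring].
Qed.

Lemma binom_weight_le_1 (p : R) (n j : nat) : 0 <= p <= 1 ->
  binom_weight p n j <= 1.
Proof.
  intros Hp; refine (Rle_trans _ _ _ _ (binom_weight_col_sum p n j Hp)).
  assert (H : forall k, 0 <= binom_weight p n k)
    by (intros; apply binom_weight_ge_0, Hp).
  destruct j; [rewrite sum_O; lra | rewrite sum_n_RS].
  assert (H1 := sum_n_ge_0 _ j H); lra.
Qed.

(** Pascal's rule summed over [n] reads [S_(j+1) = p S_j + (1 - p) S_(j+1)] for the full row sums,
    so all of them equal the geometric sum [S_0 = 1 / p]. For partial sums the two occurrences of
    [S_(j+1)] stop at different indices, which leaves an inequality. *)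
Lemma binom_weight_row_sum (p : R) (j N : nat) : 0 < p <= 1 ->
  sum_n (fun n => binom_weight p n j) N <= / p.
Proof.
  intros Hp; apply Rmult_le_reg_l with p; [lra | rewrite Rinv_r by lra].
  revert N; induction j as [ | j IH]; intros N;
    (destruct N as [ | N]; [rewrite sum_O; simpl; lra | ]).
  (* The closed form of the geometric sum, where [(1 - p)^(M + 1)] appears as [(1 - p)] times the
     last weight. *)
  - assert (E : forall M, sum_n (fun n => binom_weight p n 0) M
              <= (1 - (1 - p) * binom_weight p M 0) / p).
    { induction M as [ | M IH].
      - rewrite sum_O; simpl; apply Req_le; field; lra.
      - rewrite sum_n_RS; eapply Rle_trans; [apply Rplus_le_compat_r, IH | ].
        simpl; apply Req_le; field; lra. }
    eapply Rle_trans; [apply Rmult_le_compat_l, E; lra | ].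
    assert (H := binom_weight_ge_0 p (S N) 0).
    replace (p * ((1 - (1 - p) * binom_weight p (S N) 0) / p))
      with (1 - (1 - p) * binom_weight p (S N) 0) by (field; lra).
    nra.
  - assert (H := IH N).
    assert (H1 : sum_n (fun n => binom_weight p n (S j)) N
                 <= sum_n (fun n => binom_weight p n (S j)) (S N)).
    { apply sum_n_le_incr; [ | lia].
      intros k; apply binom_weight_ge_0; lra. }
    (* Names the longer sum [s] while keeping its equation, so that the shift expands it in [Hs]
       alone. *)
    revert H1; generalize (eq_refl (sum_n (fun n => binom_weight p n (S j)) (S N))).
    generalize (sum_n (fun n => binom_weight p n (S j)) (S N)) at 2 3 4.
    intros s Hs H1; rewrite sum_n_Rshift in Hs; simpl in Hs.
    rewrite sum_n_Rplus, !sum_n_Rmult in Hs; nra.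
Qed.

(** Goals produced by the algebraic hierarchy state equality over a structure's carrier; restating
    it over [T] lets [ring] find the ring. *)
Ltac ring_in T := match goal with |- @eq _ ?a ?b => change (@eq T a b) end; ring.

Lemma Csum_n_ext (a b : nat -> C) (n : nat) :
  (forall k, a k = b k) -> sum_n a n = sum_n b n.
Proof. apply (sum_n_ext (G := C_AbelianMonoid)). Qed.

Lemma Csum_n_mult_l (c : C) (a : nat -> C) (n : nat) :
  sum_n (fun k => c * a k)%C n = (c * sum_n a n)%C.
Proof. exact (sum_n_mult_l (K := C_Ring) c a n). Qed.

Lemma Csum_n_plus (a b : nat -> C) (n : nat) :
  sum_n (fun k => a k + b k)%C n = (sum_n a n + sum_n b n)%C.
Proof. exact (sum_n_plus (G := C_AbelianMonoid) a b n). Qed.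

Lemma Csum_n_shift (a : nat -> C) (n : nat) :
  sum_n a (S n) = (a 0%nat + sum_n (fun k => a (S k)) n)%C.
Proof. exact (sum_n_shift (G := C_AbelianMonoid) a n). Qed.

Lemma Csum_n_zero (a : nat -> C) (n : nat) :
  (forall k, a k = RtoC 0) -> sum_n a n = RtoC 0.
Proof.
  intros H; rewrite (Csum_n_ext a (fun k => 0 * a k)%C)
    by (intros k; rewrite H; symmetry; apply Cmult_0_l).
  rewrite Csum_n_mult_l; apply Cmult_0_l.
Qed.

Lemma binom_weight_genfun (p : R) (z : C) (n J : nat) : (n <= J)%nat ->
  sum_n (fun j => RtoC (binom_weight p n j) * pow_n (K := C_Ring) z j)%C J
  = pow_n (K := C_Ring) (RtoC p * z + 1 - RtoC p)%C n.
Proof.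
  revert J; induction n as [ | n IH]; intros J HJ.
  - destruct J as [ | J]; [rewrite sum_O; simpl; apply Cmult_1_l | ].
    rewrite Csum_n_shift, Csum_n_zero by (intros k; simpl; ring).
    simpl; unfold one; simpl; ring.
  - destruct J as [ | J]; [lia | ].
    assert (H1 := IH J ltac:(lia)); assert (H2 := IH (S J) ltac:(lia)).
    rewrite Csum_n_shift in H2 |- *.
    rewrite (Csum_n_ext _
      (fun k => (RtoC p * z) * (RtoC (binom_weight p n k) * pow_n (K := C_Ring) z k)
        + (1 - RtoC p) * (RtoC (binom_weight p n (S k)) * pow_n (K := C_Ring) z (S k)))%C).
    + rewrite Csum_n_plus, !Csum_n_mult_l, H1.
      change (pow_n (RtoC p * z + 1 - RtoC p)%C (S n))
        with ((RtoC p * z + 1 - RtoC p) * pow_n (K := C_Ring) (RtoC p * z + 1 - RtoC p)%C n)%C.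
      simpl binom_weight; rewrite RtoC_mult, RtoC_minus.
      rewrite <- H2; simpl pow_n; ring_in C.
    + intros k; simpl binom_weight.
      rewrite RtoC_plus, !RtoC_mult, RtoC_minus.
      change (pow_n z (S k)) with (z * pow_n (K := C_Ring) z k)%C; ring.
Qed.

(** * Composition with an affine self-map of the disc *)

Lemma C_iota_series (a : nat -> C) (l : C) : is_series a l ->
  iota (T := C_CompleteNormedModule) (is_series a) = l.
Proof.
  intros H; apply (iota_unique (V := C_CompleteNormedModule)); [ | exact H].
  intros y Hy; exact (filterlim_locally_unique (V := C_NormedModule) _ y l Hy H).
Qed.

Lemma C_ex_series_le (a : nat -> C) (b : nat -> R) :
  (forall n, Cmod (a n) <= b n) -> ex_series b ->
  exists l : C, is_series a l.
Proof. apply (ex_series_le (V := C_CompleteNormedModule)). Qed.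

Lemma is_lim_seq_Cmod (u : nat -> C) (l : C) :
  filterlim u eventually (locally l) -> is_lim_seq (fun n => Cmod (u n)) (Cmod l).
Proof.
  intros H; refine (filterlim_comp _ _ _ u Cmod _ _ _ H _).
  exact (filterlim_norm (V := C_NormedModule) l).
Qed.

Lemma Cmod_lim_le (u : nat -> C) (l : C) (M : R) :
  filterlim u eventually (locally l) ->
  eventually (fun n => Cmod (u n) <= M) -> Cmod l <= M.
Proof.
  intros H HM.
  exact (is_lim_seq_le_loc _ _ _ _ HM (is_lim_seq_Cmod u l H) (is_lim_seq_const M)).
Qed.

Lemma sum_n_le_Series (b : nat -> R) (n : nat) :
  (forall k, 0 <= b k) -> ex_series b -> sum_n b n <= Series b.
Proof.
  intros Hb Hex; refine (is_lim_seq_incr_compare _ _ (Series_correct _ Hex) _ n).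
  intros k; apply sum_n_le_incr; [exact Hb | lia].
Qed.

(** Tannery's theorem in the case where row [J] already agrees with the limit up to index [J]: the
    sums then differ by at most twice the tail of the majorant. It serves to exchange the two
    summations in the power series of [f o phi_t]. *)
Lemma series_tannery (a : nat -> nat -> C) (b : nat -> C) (D : nat -> R)
  (L : nat -> C) (l : C) :
  (forall J n, (n <= J)%nat -> a J n = b n) ->
  (forall J n, Cmod (a J n) <= D n) -> ex_series D ->
  (forall J, is_series (a J) (L J)) -> is_series b l ->
  filterlim L eventually (locally l).
Proof.
  intros Hab HaD HexD HL Hl.
  assert (HD : forall n, 0 <= D n)
    by (intros n; exact (Rle_trans _ _ _ (Cmod_ge_0 _) (HaD 0%nat n))).
  assert (HbD : forall n, Cmod (b n) <= D n)
    by (intros n; rewrite <- (Hab n n) by lia; apply HaD).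
  assert (HM : forall J, Cmod (L J - l) <= 2 * (Series D - sum_n D J)).
  { intros J.
    apply (Cmod_lim_le (fun N => sum_n (a J) N - sum_n b N)%C).
    - exact (filterlim_comp_2 (G := locally (L J)) (H := locally (opp l)) _
        (fun N => opp (sum_n b N)) (plus (G := C_AbelianMonoid)) (HL J)
        (filterlim_comp _ _ _ (sum_n b) opp _ _ _ Hl
           (filterlim_opp (V := C_NormedModule) l))
        (filterlim_plus (V := C_NormedModule) (L J) (opp l))).
    - exists J; intros N HN.
      apply Rle_trans with (2 * (sum_n D N - sum_n D J)).
      2:{ assert (H := sum_n_le_Series D N HD HexD); lra. }
      induction HN as [ | N HN IH].
      + replace (sum_n b J) with (sum_n (a J) J).
        { replace (sum_n (a J) J - sum_n (a J) J)%C with (RtoC 0) by ring_in C.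
          rewrite Cmod_0; lra. }
        apply (sum_n_ext_loc (G := C_AbelianMonoid)); intros n Hn; apply Hab, Hn.
      + rewrite (sum_Sn (a J)), (sum_Sn b), (sum_n_RS D).
        change (Cmod ((sum_n (a J) N + a J (S N)) - (sum_n b N + b (S N)))
                <= 2 * (sum_n D N + D (S N) - sum_n D J)).
        replace ((sum_n (a J) N + a J (S N)) - (sum_n b N + b (S N)))%C
          with ((sum_n (a J) N - sum_n b N) + (a J (S N) + - b (S N)))%C by ring_in C.
        assert (H1 := Cmod_triangle (sum_n (a J) N - sum_n b N) (a J (S N) + - b (S N))).
        assert (H2 := Cmod_triangle (a J (S N)) (- b (S N))).
        rewrite Cmod_opp in H2.
        assert (H3 := HaD J (S N)); assert (H4 := HbD (S N)); lra. }
  apply (filterlim_locally_ball_norm (U := C_NormedModule)); intros eps.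
  assert (Hlim := Series_correct _ HexD).
  assert (He : 0 < eps / 2) by (assert (H := cond_pos eps); lra).
  apply (filterlim_locally_ball_norm (U := R_NormedModule)) with (eps := mkposreal _ He)
    in Hlim.
  revert Hlim; apply filter_imp; intros J HJ.
  change (Rabs (sum_n D J - Series D) < eps / 2) in HJ.
  change (Cmod (L J - l) < eps).
  apply Rabs_def2 in HJ; assert (H := HM J); lra.
Qed.

Lemma Cmod_pow_n (z : C) (n : nat) : Cmod (pow_n (K := C_Ring) z n) = Cmod z ^ n.
Proof.
  induction n as [ | n IH]; [apply Cmod_1 | ].
  change (Cmod (z * pow_n (K := C_Ring) z n) = Cmod z * Cmod z ^ n).
  rewrite Cmod_mult, IH; reflexivity.
Qed.

Lemma H2_eval_correct (f : H2) (z : C) : Cmod z < 1 ->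
  is_series (fun n => pow_n (K := C_Ring) z n * coef f n)%C (H2_eval f z).
Proof.
  intros Hz.
  destruct (C_ex_series_le (fun n => pow_n (K := C_Ring) z n * coef f n)%C
              (fun n => H2_norm f * Cmod z ^ n)) as [l Hl].
  - intros n; rewrite Cmod_mult, Rmult_comm; apply Rmult_le_compat;
      try apply Cmod_ge_0; [apply coef_le_norm | ].
    rewrite Cmod_pow_n; apply Rle_refl.
  - apply (ex_series_scal (V := R_NormedModule)), ex_series_geom.
    rewrite Rabs_pos_eq; [exact Hz | apply Cmod_ge_0].
  - assert (E : H2_eval f z = l) by exact (C_iota_series _ l Hl).
    rewrite E; exact Hl.
Qed.

Lemma coef_mult_ex_series (u : nat -> R) (f : H2) :
  (forall n, 0 <= u n) -> ex_series u ->
  exists l : C, is_series (fun n => RtoC (u n) * coef f n)%C l.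
Proof.
  intros Hu Hex; apply C_ex_series_le with (fun n => H2_norm f * u n).
  - intros n; rewrite Cmod_mult, Cmod_R, Rabs_pos_eq, Rmult_comm by auto.
    apply Rmult_le_compat_r; [auto | apply coef_le_norm].
  - apply (ex_series_scal (V := R_NormedModule)), Hex.
Qed.

Definition comp_coef (p : R) (f : H2) (j : nat) : C :=
  iota (T := C_CompleteNormedModule)
    (is_series (fun n => RtoC (binom_weight p n j) * coef f n)%C).

Section AffineComposition.

Context (p : R) (Hp : 0 < p <= 1).

Let w_ge_0 (n j : nat) : 0 <= binom_weight p n j.
Proof. apply binom_weight_ge_0; lra. Qed.

Lemma binom_weight_row_ex (j : nat) : ex_series (fun n => binom_weight p n j).
Proof.
  apply ex_series_bounded with (/ p); [intros n; apply w_ge_0 | ].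
  intros N; apply binom_weight_row_sum, Hp.
Qed.

Lemma comp_coef_correct (f : H2) (j : nat) :
  is_series (fun n => RtoC (binom_weight p n j) * coef f n)%C (comp_coef p f j).
Proof.
  destruct (coef_mult_ex_series (fun n => binom_weight p n j) f) as [l Hl].
  - intros n; apply w_ge_0.
  - apply binom_weight_row_ex.
  - unfold comp_coef; rewrite (C_iota_series _ l Hl); exact Hl.
Qed.

(* Schur's test: for fixed [n] the weights sum to at most 1 over [j], for fixed
   [j] to at most [1 / p] over [n]. *)
Lemma comp_coef_bound (f : H2) (J : nat) :
  sum_n (fun j => Cmod (comp_coef p f j) ^ 2) J <= / p * H2_norm f ^ 2.
Proof.
  (* The estimate is made for the truncations at [N], where exchanging sums is a finite matter, and
     passes to the limit in [N]. *)
  set (s := fun N j => sum_n (fun n => RtoC (binom_weight p n j) * coef f n)%C N).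
  assert (Hlim : is_lim_seq (fun N => sum_n (fun j => Cmod (s N j) ^ 2) J)
                   (sum_n (fun j => Cmod (comp_coef p f j) ^ 2) J)).
  { assert (H : forall j, is_lim_seq (fun N => Cmod (s N j) ^ 2)
                            (Cmod (comp_coef p f j) ^ 2)).
    { intros j; assert (H := is_lim_seq_Cmod _ _ (comp_coef_correct f j)).
      simpl; apply is_lim_seq_mult'; [exact H | ].
      apply is_lim_seq_mult'; [exact H | apply is_lim_seq_const]. }
    induction J as [ | J IH].
    - rewrite sum_O; eapply is_lim_seq_ext; [ | apply H].
      intros N; rewrite sum_O; reflexivity.
    - rewrite sum_n_RS; eapply is_lim_seq_ext;
        [ | apply is_lim_seq_plus'; [exact IH | apply H]].
      intros N; rewrite sum_n_RS; reflexivity. }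
  refine (is_lim_seq_le _ _ (Finite _) (Finite _) _ Hlim (is_lim_seq_const _)).
  intros N.
  apply Rle_trans with
    (sum_n (fun j => / p * sum_n (fun n => binom_weight p n j * Cmod (coef f n) ^ 2) N) J).
  - apply sum_n_Rle; intros j.
    apply Rle_trans with
      ((sum_n (fun n => binom_weight p n j * Cmod (coef f n)) N) ^ 2).
    + apply pow_incr; split; [apply Cmod_ge_0 | ].
      eapply Rle_trans; [apply Cmod_sum_n | apply Req_le, sum_n_ext].
      intros n; rewrite Cmod_mult, Cmod_R, Rabs_pos_eq by apply w_ge_0; reflexivity.
    + eapply Rle_trans.
      * apply (weighted_cauchy_schwarz (fun n => binom_weight p n j));
          [intros n; apply w_ge_0 | intros n; apply Cmod_ge_0].
      * apply Rmult_le_compat_r; [ | apply binom_weight_row_sum, Hp].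
        apply sum_n_ge_0; intros n; apply Rmult_le_pos; [apply w_ge_0 | apply pow2_ge_0].
  - rewrite sum_n_Rmult; apply Rmult_le_compat_l.
    { left; apply Rinv_0_lt_compat; lra. }
    rewrite (sum_n_switch (G := R_AbelianMonoid)).
    refine (Rle_trans _ _ _ _ (sum_sq_le_norm f N)).
    apply sum_n_Rle; intros n.
    rewrite (sum_n_ext _ (fun j => Cmod (coef f n) ^ 2 * binom_weight p n j))
      by (intros j; apply Rmult_comm).
    rewrite sum_n_Rmult, <- Rmult_1_r.
    apply Rmult_le_compat_l; [apply pow2_ge_0 | apply binom_weight_col_sum; lra].
Qed.

Definition comp_H2 (f : H2) : H2 :=
  mkH2 (comp_coef p f) (l2_of_bounded _ _ (comp_coef_bound f)).

Lemma Cmod_affine (z : C) :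
  Cmod (RtoC p * z + 1 - RtoC p) <= p * Cmod z + (1 - p).
Proof.
  replace (RtoC p * z + 1 - RtoC p)%C with (RtoC p * z + RtoC (1 - p))%C
    by (rewrite RtoC_minus; ring).
  eapply Rle_trans; [apply Cmod_triangle | ].
  rewrite Cmod_mult, !Cmod_R, !Rabs_pos_eq by lra; lra.
Qed.

(** The [J]-th partial sum of the power series on the left is a series over [n] in which
    [(p z + 1 - p)^n] is replaced by its expansion cut at [J]. The majorant is geometric of ratio
    [p |z| + 1 - p < 1], and Tannery's theorem lets [J] tend to infinity. *)
Lemma comp_H2_eval (f : H2) (z : C) : Cmod z < 1 ->
  H2_eval (comp_H2 f) z = H2_eval f (RtoC p * z + 1 - RtoC p)%C.
Proof.
  intros Hz.
  assert (Hz0 := Cmod_ge_0 z).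
  set (zeta := (RtoC p * z + 1 - RtoC p)%C).
  assert (Hr : p * Cmod z + (1 - p) < 1) by nra.
  assert (Hzeta : Cmod zeta < 1)
    by (eapply Rle_lt_trans; [apply Cmod_affine | exact Hr]).
  refine (filterlim_locally_unique (V := C_NormedModule) _ _ _
            (H2_eval_correct (comp_H2 f) z Hz) _).
  apply (series_tannery
    (fun J n => coef f n * sum_n (fun j => RtoC (binom_weight p n j)
                                     * pow_n (K := C_Ring) z j) J)%C
    (fun n => pow_n (K := C_Ring) zeta n * coef f n)%C
    (fun n => H2_norm f * (p * Cmod z + (1 - p)) ^ n)).
  - intros J n Hn; rewrite binom_weight_genfun by exact Hn; apply Cmult_comm.
  - intros J n; rewrite Cmod_mult.
    apply Rmult_le_compat; try apply Cmod_ge_0; [apply coef_le_norm | ].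
    eapply Rle_trans; [apply Cmod_sum_n | ].
    refine (Rle_trans _ _ _ _ (binom_weight_genfun_le p (Cmod z) n J _ Hz0)); [ | lra].
    apply sum_n_Rle; intros j.
    rewrite Cmod_mult, Cmod_R, Rabs_pos_eq by apply w_ge_0.
    apply Rmult_le_compat_l; [apply w_ge_0 | ].
    rewrite Cmod_pow_n; apply Rle_refl.
  - apply (ex_series_scal (V := R_NormedModule)), ex_series_geom.
    rewrite Rabs_pos_eq; [exact Hr | nra].
  - intros J.
    assert (Hj : forall j, is_series (fun n => coef f n *
                   (RtoC (binom_weight p n j) * pow_n (K := C_Ring) z j))%C
                   (pow_n (K := C_Ring) z j * comp_coef p f j)%C).
    { intros j; eapply is_series_ext;
        [ | exact (is_series_scal (V := C_NormedModule) (pow_n (K := C_Ring) z j) _ _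
                     (comp_coef_correct f j))].
      intros n; unfold scal; simpl; unfold mult; simpl; ring_in C. }
    induction J as [ | J IH].
    + rewrite sum_O; eapply is_series_ext; [ | apply (Hj 0%nat)].
      intros n; rewrite sum_O; reflexivity.
    + rewrite sum_Sn; eapply is_series_ext;
        [ | exact (is_series_plus (V := C_NormedModule) _ _ _ _ IH (Hj (S J)))].
      intros n; rewrite (sum_Sn (G := C_AbelianMonoid)); unfold plus; simpl plus.
      symmetry; apply Cmult_plus_distr_l.
  - exact (H2_eval_correct f zeta Hzeta).
Qed.

End AffineComposition.

(** * The adjoint on monomials *)

Lemma is_series_linear {K : AbsRing} {U V : NormedModule K} (L : U -> V)
  (a : nat -> U) (l : U) :
  is_linear L -> is_series a l -> is_series (fun n => L (a n)) (L l).
Proof.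
  intros HL Ha.
  apply (filterlim_ext (fun n => L (sum_n a n))).
  - induction x as [ | n IH]; [rewrite !sum_O; reflexivity | ].
    rewrite !sum_Sn, (linear_plus L HL), IH; reflexivity.
  - exact (filterlim_comp _ _ _ _ L _ _ _ Ha (linear_cont L l HL)).
Qed.

(* [C_NormedModule] has complex scalars, [C_R_NormedModule] real ones; they have
   the same sums and the same topology. *)
Lemma is_series_Re_Im (a : nat -> C) (l : C) : is_series a l ->
  is_series (fun n => Re (a n)) (Re l) /\ is_series (fun n => Im (a n)) (Im l).
Proof.
  intros H; change (is_series (V := C_R_NormedModule) a l) in H; split.
  - exact (is_series_linear (U := C_R_NormedModule) (V := R_NormedModule)
             fst a l is_linear_fst H).
  - exact (is_series_linear (U := C_R_NormedModule) (V := R_NormedModule)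
             snd a l is_linear_snd H).
Qed.

Lemma bounded_PSeries_inj (a b : nat -> R) (M : R) :
  (forall n, Rabs (a n) <= M) -> (forall n, Rabs (b n) <= M) ->
  (forall x, Rabs x < 1 -> PSeries a x = PSeries b x) -> forall n, a n = b n.
Proof.
  intros Ha Hb Heq n.
  assert (Hcv : forall c, (forall k, Rabs (c k) <= M) -> Rbar_lt 0 (CV_radius c)).
  { intros c Hc; apply Rbar_lt_le_trans with (Finite 1); [apply Rlt_0_1 | ].
    apply (proj1 (CV_radius_bounded c)); exists M; intros k; rewrite pow1, Rmult_1_r; apply Hc. }
  apply PSeries_ext_recip; auto.
  exists (mkposreal 1 Rlt_0_1); intros x Hx; apply Heq.
  change (Rabs (x - 0) < 1) in Hx; rewrite Rminus_0_r in Hx; exact Hx.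
Qed.

Lemma pow_n_RtoC (x : R) (n : nat) :
  pow_n (K := C_Ring) (RtoC x) n = RtoC (x ^ n).
Proof.
  induction n as [ | n IH]; [reflexivity | ].
  change (pow_n (RtoC x) (S n)) with (RtoC x * pow_n (K := C_Ring) (RtoC x) n)%C.
  rewrite IH, <- RtoC_mult; reflexivity.
Qed.

(** Values at real points of the disc suffice: there the real and imaginary parts are real power
    series with bounded coefficients, and uniqueness for those applies. *)
Lemma H2_eval_inj (f g : H2) :
  (forall z, Cmod z < 1 -> H2_eval f z = H2_eval g z) -> f = g.
Proof.
  intros Heq.
  assert (HP : forall (h : H2) x, Rabs x < 1 ->
    PSeries (fun n => Re (coef h n)) x = Re (H2_eval h (RtoC x)) /\
    PSeries (fun n => Im (coef h n)) x = Im (H2_eval h (RtoC x))).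
  { intros h x Hx; rewrite <- Cmod_R in Hx.
    destruct (is_series_Re_Im _ _ (H2_eval_correct h _ Hx)) as [H1 H2'].
    split; apply is_series_unique;
      [revert H1 | revert H2']; apply is_series_ext; intros n;
      rewrite pow_n_RtoC; unfold Re, Im; simpl; ring. }
  assert (HM : forall n, Cmod (coef f n) <= Rmax (H2_norm f) (H2_norm g) /\
                         Cmod (coef g n) <= Rmax (H2_norm f) (H2_norm g)).
  { intros n; split; eapply Rle_trans;
      [apply coef_le_norm | apply Rmax_l | apply coef_le_norm | apply Rmax_r]. }
  apply H2_ext; intros n.
  assert (Hn : forall x, Rabs x < 1 -> H2_eval f (RtoC x) = H2_eval g (RtoC x))
    by (intros x Hx; apply Heq; rewrite Cmod_R; exact Hx).
  apply injective_projections.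
  - apply (bounded_PSeries_inj (fun k => Re (coef f k)) (fun k => Re (coef g k))
             (Rmax (H2_norm f) (H2_norm g))).
    1, 2: intros k; refine (Rle_trans _ _ _ (Rmax_l _ _) _);
      refine (Rle_trans _ _ _ (Rmax_Cmod _) _); apply HM.
    intros x Hx; rewrite (proj1 (HP f x Hx)), (proj1 (HP g x Hx)), (Hn x Hx); reflexivity.
  - apply (bounded_PSeries_inj (fun k => Im (coef f k)) (fun k => Im (coef g k))
             (Rmax (H2_norm f) (H2_norm g))).
    1, 2: intros k; refine (Rle_trans _ _ _ (Rmax_r _ _) _);
      refine (Rle_trans _ _ _ (Rmax_Cmod _) _); apply HM.
    intros x Hx; rewrite (proj2 (HP f x Hx)), (proj2 (HP g x Hx)), (Hn x Hx); reflexivity.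
Qed.

Lemma exp_opp_range (t : R) : 0 <= t -> 0 < exp (- t) <= 1.
Proof.
  intros Ht; split; [apply exp_pos | ].
  rewrite <- exp_0; destruct Ht as [Ht | <-];
    [left; apply exp_increasing; lra | rewrite Ropp_0; lra].
Qed.

Lemma composition_op_phi (t : R) (Ht : 0 <= t) (f : H2) :
  composition_op (phi t) f = comp_H2 (exp (- t)) (exp_opp_range t Ht) f.
Proof.
  apply (iota_unique (V := H2_CompleteNormedModule)).
  - intros g Hg; apply H2_eval_inj; intros z Hz.
    rewrite Hg, comp_H2_eval by exact Hz; reflexivity.
  - intros z Hz; apply comp_H2_eval, Hz.
Qed.

Lemma is_series_single (a : nat -> C) (i : nat) :
  (forall n, n <> i -> a n = RtoC 0) -> is_series a (a i).
Proof.
  intros Ha; apply (filterlim_ext_loc (fun _ => a i)); [ | apply filterlim_const].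
  exists i; intros n Hn; induction Hn as [ | n Hn IH].
  - destruct i as [ | i]; [rewrite sum_O; reflexivity | rewrite sum_Sn].
    rewrite (sum_n_ext_loc (G := C_AbelianMonoid) _ (fun _ => RtoC 0)).
    + rewrite (Csum_n_zero (fun _ => RtoC 0)) by reflexivity.
      symmetry; apply Cplus_0_l.
    + intros k Hk; apply Ha; lia.
  - rewrite sum_Sn, <- IH, (Ha (S n)) by lia; symmetry; apply Cplus_0_r.
Qed.

Lemma H2_inner_monomial_r (f : H2) (i : nat) :
  H2_inner f (H2_monomial i) = coef f i.
Proof.
  apply C_iota_series.
  replace (coef f i) with (coef f i * Cconj (coef (H2_monomial i) i))%C.
  - apply (is_series_single (fun n => coef f n * Cconj (coef (H2_monomial i) n))%C).
    intros n Hn; simpl; destruct (Nat.eqb_spec n i); [contradiction | ].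
    apply injective_projections; simpl; ring.
  - simpl; rewrite Nat.eqb_refl; apply injective_projections; simpl; ring.
Qed.

Lemma H2_inner_monomial_l (f : H2) (i : nat) :
  H2_inner (H2_monomial i) f = Cconj (coef f i).
Proof.
  apply C_iota_series.
  replace (Cconj (coef f i)) with (coef (H2_monomial i) i * Cconj (coef f i))%C.
  - apply (is_series_single (fun n => coef (H2_monomial i) n * Cconj (coef f n))%C).
    intros n Hn; simpl; destruct (Nat.eqb_spec n i); [contradiction | ].
    apply injective_projections; simpl; ring.
  - simpl; rewrite Nat.eqb_refl; apply injective_projections; simpl; ring.
Qed.

Lemma matrix_entry_coef (B : H2 -> H2) (i j : nat) :
  matrix_entry B i j = coef (B (H2_monomial j)) i.
Proof. apply H2_inner_monomial_r. Qed.

Lemma binom_weight_sq_sum (p : R) (j N : nat) : 0 < p <= 1 ->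
  sum_n (fun n => Cmod (RtoC (binom_weight p n j)) ^ 2) N <= / p.
Proof.
  intros Hp; refine (Rle_trans _ _ _ _ (binom_weight_row_sum p j N Hp)).
  apply sum_n_Rle; intros n.
  assert (H0 := binom_weight_ge_0 p n j); assert (H1 := binom_weight_le_1 p n j).
  rewrite Cmod_R, Rabs_pos_eq by (apply H0; lra); simpl; nra.
Qed.

(** The functional sending [f] to the [j]-th coefficient of [f o phi_t] is the pairing with row [j]
    of the matrix, which is square-summable and real, so conjugation leaves it unchanged. *)
Lemma adjoint_phi_monomial (t : R) (j n : nat) : 0 <= t ->
  coef (adjoint (composition_op (phi t)) (H2_monomial j)) n
  = RtoC (binom_weight (exp (- t)) n j).
Proof.
  intros Ht; assert (Hp := exp_opp_range t Ht).
  set (h := mkH2 _ (l2_of_bounded (fun n => RtoC (binom_weight (exp (- t)) n j)) _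
                      (fun N => binom_weight_sq_sum _ j N Hp))).
  assert (Hh : forall f, H2_inner (composition_op (phi t) f) (H2_monomial j)
                         = H2_inner f h).
  { intros f; rewrite (composition_op_phi t Ht), H2_inner_monomial_r.
    symmetry; apply C_iota_series.
    eapply is_series_ext; [ | exact (comp_coef_correct _ Hp f j)].
    intros k; simpl; apply injective_projections; simpl; ring. }
  enough (E : adjoint (composition_op (phi t)) (H2_monomial j) = h)
    by (rewrite E; reflexivity).
  apply (iota_unique (V := H2_CompleteNormedModule)); [ | exact Hh].
  (* Uniqueness: testing the adjoint identity against [z^m] recovers every coefficient. *)
  intros g Hg; apply H2_ext; intros m.
  rewrite <- (Cconj_conj (coef g m)), <- (Cconj_conj (coef h m)).
  rewrite <- !H2_inner_monomial_l, <- Hg, <- Hh; reflexivity.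
Qed.

(** * Improper integrals over (0, +oo) *)

Lemma plus_plus_minus {G : AbelianGroup} (x y z : G) :
  minus (plus (plus x y) z) y = plus x z.
Proof.
  unfold minus; rewrite (plus_comm x y), <- (plus_assoc y x z), plus_comm, plus_assoc.
  rewrite plus_opp_l, plus_zero_l; reflexivity.
Qed.

Lemma Riemann_sum_linear {U V : NormedModule R_AbsRing} (L : U -> V) (f : R -> U)
  (ptd : SF_seq) :
  is_linear L -> L (Riemann_sum f ptd) = Riemann_sum (fun t => L (f t)) ptd.
Proof.
  intros HL; apply SF_cons_ind with (s := ptd); clear ptd.
  - intros x0; exact (linear_zero L HL).
  - intros h s IH; rewrite !Riemann_sum_cons, (linear_plus L HL), IH.
    f_equal; apply (linear_scal L HL).
Qed.

Lemma is_RInt_linear {U V : NormedModule R_AbsRing} (L : U -> V) (f : R -> U)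
  (a b : R) (l : U) :
  is_linear L -> is_RInt f a b l -> is_RInt (fun t => L (f t)) a b (L l).
Proof.
  intros HL Hf.
  refine (filterlim_ext (fun ptd => L (scal (sign (b - a)) (Riemann_sum f ptd))) _ _ _).
  - intros ptd; rewrite (linear_scal L HL), (Riemann_sum_linear L f ptd HL); reflexivity.
  - exact (filterlim_comp _ _ _ _ L _ _ _ Hf (linear_cont L l HL)).
Qed.

(** Applied to taking a coefficient, taking the real part, and multiplying by a complex constant,
    which is not a scalar of the real module structure. *)
Lemma is_RInt_gen_linear {U V : NormedModule R_AbsRing} (L : U -> V) (f : R -> U)
  (Fa Fb : (R -> Prop) -> Prop) (l : U) : Filter Fa -> Filter Fb ->
  is_linear L -> is_RInt_gen f Fa Fb l ->
  is_RInt_gen (fun t => L (f t)) Fa Fb (L l).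
Proof.
  intros HFa HFb HL Hf P HP.
  specialize (Hf (fun x => P (L x)) (linear_cont L l HL P HP)).
  unfold filtermapi in *; revert Hf; apply filter_imp.
  intros ab [y [Hy HPy]]; exists (L y); split; [ | exact HPy].
  apply is_RInt_linear; assumption.
Qed.

Notation is_RInt_pos f l := (is_RInt_gen f (at_right 0) (Rbar_locally p_infty) l).

Lemma at_right_0_pos : at_right 0 (fun t => 0 < t).
Proof. exists (mkposreal 1 Rlt_0_1); intros y _ Hy; exact Hy. Qed.

Lemma p_infty_gt (M : R) : Rbar_locally p_infty (fun t => M < t).
Proof. exists M; intros x Hx; exact Hx. Qed.

Lemma filter_prod_pos :
  filter_prod (at_right 0) (Rbar_locally p_infty)
    (fun ab => 0 < fst ab /\ 0 < snd ab).
Proof.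
  exists (fun t => 0 < t) (fun t => 0 < t);
    [exact at_right_0_pos | exact (p_infty_gt 0) | intros a b Ha Hb; split; assumption].
Qed.

Lemma filter_prod_pos_le :
  filter_prod (at_right 0) (Rbar_locally p_infty)
    (fun ab => 0 < fst ab <= snd ab).
Proof.
  exists (fun t => 0 < t < 1) (fun t => 1 < t);
    [ | exact (p_infty_gt 1) | simpl; intros a b Ha Hb; lra].
  exists (mkposreal 1 Rlt_0_1); intros y Hy Hy0.
  change (Rabs (y - 0) < 1) in Hy; apply Rabs_def2 in Hy; lra.
Qed.

Lemma between_pos (a b x : R) : 0 < a -> 0 < b -> Rmin a b <= x -> 0 < x.
Proof. intros Ha Hb; apply Rlt_le_trans, Rmin_pos; assumption. Qed.

Lemma is_RInt_pos_ext {V : NormedModule R_AbsRing} (f g : R -> V) (l : V) :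
  (forall t, 0 < t -> f t = g t) -> is_RInt_pos f l -> is_RInt_pos g l.
Proof.
  intros Hfg; apply is_RInt_gen_ext.
  generalize filter_prod_pos; apply filter_imp; intros [a b] [Ha Hb] x [Hx _].
  apply Hfg, (between_pos a b); simpl in *; lra.
Qed.

Lemma is_RInt_pos_derive {V : CompleteNormedModule R_AbsRing} (f df : R -> V)
  (la lb : V) :
  (forall t, 0 < t -> is_derive f t (df t)) ->
  (forall t, 0 < t -> continuous df t) ->
  filterlim f (at_right 0) (locally la) ->
  filterlim f (Rbar_locally p_infty) (locally lb) ->
  is_RInt_pos df (minus lb la).
Proof.
  intros Hd Hc Hla Hlb.
  apply (filterlimi_lim_ext_loc (fun ab => minus (f (snd ab)) (f (fst ab)))).
  - generalize filter_prod_pos; apply filter_imp; intros [a b] [Ha Hb].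
    apply is_RInt_derive; intros x [Hx _];
      [apply Hd | apply Hc]; apply (between_pos a b); assumption.
  - apply (filterlim_comp_2 (G := locally lb) (H := locally (opp la)) _ _ plus).
    + exact (filterlim_comp _ _ _ snd f _ _ _ filterlim_snd Hlb).
    + apply (filterlim_comp _ _ _ (fun ab => f (fst ab)) opp _ (locally la)).
      * exact (filterlim_comp _ _ _ fst f _ _ _ filterlim_fst Hla).
      * exact (filterlim_opp (V := V) la).
    + exact (filterlim_plus (V := V) lb (opp la)).
Qed.

Lemma ex_RInt_pos {V : CompleteNormedModule R_AbsRing} (f : R -> V) (a b : R) :
  (forall t, 0 < t -> continuous f t) -> 0 < a -> 0 < b -> ex_RInt f a b.
Proof.
  intros Hc Ha Hb; apply ex_RInt_continuous; intros x [Hx _].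
  apply Hc, (between_pos a b); assumption.
Qed.

(** The absolute value covers both orders of [a] and [b]: Cauchy's criterion compares endpoints in
    no particular order. *)
Lemma norm_RInt_dominated {V : CompleteNormedModule R_AbsRing} (f : R -> V)
  (g G : R -> R) (a b : R) (I : V) :
  (forall t, 0 < t -> norm (f t) <= g t) ->
  (forall t, 0 < t -> is_derive G t (g t)) ->
  (forall t, 0 < t -> continuous g t) ->
  0 < a -> 0 < b -> is_RInt f a b I -> norm I <= Rabs (G b - G a).
Proof.
  intros Hfg HG Hg.
  assert (Hle : forall a b I, 0 < a <= b -> is_RInt f a b I ->
                  norm I <= Rabs (G b - G a)).
  { clear a b I; intros a b I Hab HI.
    refine (Rle_trans _ _ _ _ (Rle_abs _)).
    apply (norm_RInt_le f g a b I (minus (G b) (G a))); [lra | | exact HI | ].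
    - intros x Hx; apply Hfg; lra.
    - apply (is_RInt_derive (V := R_CompleteNormedModule));
        intros x [Hx _]; rewrite Rmin_left in Hx by lra; [apply HG | apply Hg]; lra. }
  intros Ha Hb HI; destruct (Rle_lt_dec a b) as [Hab | Hab]; [apply Hle; auto | ].
  rewrite Rabs_minus_sym, <- norm_opp.
  apply Hle; [lra | apply is_RInt_swap, HI].
Qed.

(* [G] is an antiderivative of the dominating function [g]: Cauchy's criterion
   for [f] then reduces to the convergence of [G] at both ends. *)
Lemma ex_RInt_pos_dominated {V : CompleteNormedModule R_AbsRing} (f : R -> V)
  (g G : R -> R) (la lb : R) :
  (forall t, 0 < t -> continuous f t) ->
  (forall t, 0 < t -> norm (f t) <= g t) ->
  (forall t, 0 < t -> is_derive G t (g t)) ->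
  (forall t, 0 < t -> continuous g t) ->
  filterlim G (at_right 0) (locally la) ->
  filterlim G (Rbar_locally p_infty) (locally lb) ->
  exists l : V, is_RInt_pos f l.
Proof.
  intros Hf Hfg HG Hg Hla Hlb.
  apply (filterlimi_locally_cauchy (U := V)).
  - generalize filter_prod_pos; apply filter_imp; intros [a b] [Ha Hb]; split.
    + exact (ex_RInt_pos f a b Hf Ha Hb).
    + intros y1 y2 H1 H2.
      rewrite <- (is_RInt_unique _ _ _ _ H1); apply is_RInt_unique, H2.
  - intros eps.
    assert (He : 0 < eps / 4) by (assert (H := cond_pos eps); lra).
    exists (fun ab => (0 < fst ab /\ 0 < snd ab) /\
              (Rabs (G (fst ab) - la) < eps / 4 /\ Rabs (G (snd ab) - lb) < eps / 4)).
    split.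
    + apply filter_and; [exact filter_prod_pos | ].
      exists (fun a => Rabs (G a - la) < eps / 4) (fun b => Rabs (G b - lb) < eps / 4);
        [ | | intros a b Ha Hb; split; assumption].
      * exact (proj1 (filterlim_locally G la) Hla (mkposreal _ He)).
      * exact (proj1 (filterlim_locally G lb) Hlb (mkposreal _ He)).
    + intros [a b] [c d] [[Ha Hb] [HGa HGb]] [[Hc Hd] [HGc HGd]] I J HI HJ; simpl in *.
      destruct (ex_RInt_pos f c a Hf Hc Ha) as [A HA].
      destruct (ex_RInt_pos f b d Hf Hb Hd) as [B HB].
      (* Going from [c] to [d] through [a] and [b], the difference of the two integrals is the sum
         of two end pieces, each below [eps / 2]. *)
      assert (EJ : J = plus (plus A I) B).
      { rewrite <- (is_RInt_unique _ _ _ _ HJ); apply is_RInt_unique.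
        apply is_RInt_Chasles with b; [ | exact HB].
        apply is_RInt_Chasles with a; assumption. }
      assert (EIJ : minus J I = plus A B).
      { rewrite EJ; exact (plus_plus_minus (G := V) A I B). }
      apply (norm_compat1 (V := V)).
      refine (eq_ind_r (fun v => norm v < eps) _ EIJ).
      eapply Rle_lt_trans; [apply (norm_triangle (V := V)) | ].
      assert (H1 := norm_RInt_dominated f g G c a A Hfg HG Hg Hc Ha HA).
      assert (H2 := norm_RInt_dominated f g G b d B Hfg HG Hg Hb Hd HB).
      apply Rabs_def2 in HGa, HGb, HGc, HGd.
      assert (Rabs (G a - G c) < eps / 2) by (apply Rabs_def1; lra).
      assert (Rabs (G d - G b) < eps / 2) by (apply Rabs_def1; lra).
      lra.
Qed.

Lemma is_RInt_pos_ge_0 (f : R -> R) (l : R) :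
  (forall t, 0 < t -> 0 <= f t) -> is_RInt_pos f l -> 0 <= l.
Proof.
  intros Hf Hl; apply Rle_trans with (norm l); [apply Rabs_pos | ].
  refine (RInt_gen_norm (V := R_CompleteNormedModule) f f l l _ _ Hl Hl).
  - generalize filter_prod_pos_le; apply filter_imp; intros ab H; lra.
  - generalize filter_prod_pos_le; apply filter_imp; intros ab H x Hx.
    apply Req_le, Rabs_pos_eq, Hf; lra.
Qed.

Lemma is_RInt_pos_le (f g : R -> R) (lf lg : R) :
  (forall t, 0 < t -> f t <= g t) ->
  is_RInt_pos f lf -> is_RInt_pos g lg -> lf <= lg.
Proof.
  intros Hfg Hf Hg; enough (0 <= lg - lf) by lra.
  apply (is_RInt_pos_ge_0 (fun t => g t - f t)).
  - intros t Ht; specialize (Hfg t Ht); lra.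
  - exact (is_RInt_gen_minus (V := R_NormedModule) g f lg lf Hg Hf).
Qed.

(** Were the limit below [c], some integral over an interval containing [[1, 2]] would be below [c],
    although its middle piece alone is at least [c]. *)
Lemma is_RInt_pos_gt_0 (f : R -> R) (l c : R) :
  (forall t, 0 < t -> continuous f t) ->
  (forall t, 0 < t -> 0 <= f t) -> 0 < c -> (forall t, 1 < t < 2 -> c <= f t) ->
  is_RInt_pos f l -> 0 < l.
Proof.
  intros Hc Hf Hc0 Hcf Hl; apply Rlt_le_trans with c; [exact Hc0 | ].
  apply Rnot_lt_le; intros Hlc.
  assert (HP : locally l (fun y => y < c)) by (apply (open_lt c); exact Hlc).
  specialize (Hl _ HP); unfold filtermapi in Hl.
  assert (H12 : filter_prod (at_right 0) (Rbar_locally p_infty)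
                  (fun ab => 0 < fst ab < 1 /\ 2 < snd ab)).
  { exists (fun t => 0 < t < 1) (fun t => 2 < t);
      [ | exact (p_infty_gt 2) | intros; split; assumption].
    exists (mkposreal 1 Rlt_0_1); intros y Hy Hy0.
    change (Rabs (y - 0) < 1) in Hy; apply Rabs_def2 in Hy; lra. }
  destruct (filter_ex _ (filter_and _ _ H12 Hl)) as [[a b] [[Ha Hb] [y [Hy Hyc]]]].
  simpl in *.
  assert (Hex : forall u v, 0 < u -> 0 < v -> is_RInt f u v (RInt f u v)).
  { intros u v Hu Hv; apply (RInt_correct (V := R_CompleteNormedModule)).
    apply (ex_RInt_pos (V := R_CompleteNormedModule)); assumption. }
  assert (H0 : forall u v, 0 < u <= v -> 0 <= RInt f u v).
  { intros u v Huv; apply RInt_ge_0; [lra | exists (RInt f u v); apply Hex; lra | ].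
    intros x Hx; apply Hf; lra. }
  assert (Hmid : c <= RInt f 1 2).
  { assert (Hk := is_RInt_const (V := R_NormedModule) 1 2 c).
    change (scal (2 - 1) c) with ((2 - 1) * c) in Hk.
    replace ((2 - 1) * c) with c in Hk by ring.
    exact (is_RInt_le _ f 1 2 c _ ltac:(lra) Hk (Hex 1 2 ltac:(lra) ltac:(lra)) Hcf). }
  assert (Hsum : y = RInt f a 1 + (RInt f 1 2 + RInt f 2 b)).
  { rewrite <- (is_RInt_unique _ _ _ _ Hy); apply is_RInt_unique.
    apply (is_RInt_Chasles (V := R_NormedModule)) with 1; [apply Hex; lra | ].
    apply (is_RInt_Chasles (V := R_NormedModule)) with 2; apply Hex; lra. }
  assert (H1 := H0 a 1); assert (H2 := H0 2 b); lra.
Qed.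

(** The substitution [t -> m t] preserves both ends, approach to 0 from the right and to
    infinity. *)
Lemma is_RInt_pos_dilate {V : NormedModule R_AbsRing} (f : R -> V) (l : V) (m : R) :
  0 < m -> is_RInt_pos f l -> is_RInt_pos (fun t => scal m (f (m * t))) l.
Proof.
  intros Hm Hl P HP; specialize (Hl P HP).
  unfold filtermapi in *; destruct Hl as [Q S HQ HS HQS].
  exists (fun a => Q (m * a)) (fun b => S (m * b)).
  - destruct HQ as [d Hd].
    assert (Hd' : 0 < d / m) by (apply Rdiv_lt_0_compat; [apply cond_pos | exact Hm]).
    exists (mkposreal _ Hd'); intros y Hy Hy0.
    change (Rabs (y - 0) < d / m) in Hy; apply Hd; [ | nra].
    change (Rabs (m * y - 0) < d).
    replace (m * y - 0) with (m * (y - 0)) by ring.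
    rewrite Rabs_mult, (Rabs_pos_eq m) by lra.
    apply Rmult_lt_compat_l with (r := m) in Hy; [ | exact Hm].
    replace (m * (d / m)) with (pos d) in Hy by (field; lra); exact Hy.
  - destruct HS as [M HM]; exists (M / m); intros x Hx; apply HM.
    apply Rmult_lt_compat_l with (r := m) in Hx; [ | exact Hm].
    replace (m * (M / m)) with M in Hx by (field; lra); exact Hx.
  - intros a b Ha Hb; destruct (HQS _ _ Ha Hb) as [y [Hy HPy]].
    exists y; split; [ | exact HPy]; simpl in *.
    apply (is_RInt_ext (fun t => scal m (f (m * t + 0)))).
    + intros x _; rewrite Rplus_0_r; reflexivity.
    + apply is_RInt_comp_lin; rewrite !Rplus_0_r; exact Hy.
Qed.

(** * The Gamma integral *)

Lemma Cexp_plus (z w : C) : Cexp (z + w) = (Cexp z * Cexp w)%C.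
Proof.
  unfold Cexp; destruct z as [a b], w as [c d]; simpl.
  rewrite exp_plus, cos_plus, sin_plus.
  apply injective_projections; simpl; ring.
Qed.

Lemma Cexp_0 : Cexp 0 = 1.
Proof.
  unfold Cexp; simpl; rewrite exp_0, cos_0, sin_0.
  apply injective_projections; simpl; ring.
Qed.

Lemma Rcpow_plus (t : R) (s s' : C) :
  Rcpow t (s + s') = (Rcpow t s * Rcpow t s')%C.
Proof.
  unfold Rcpow; rewrite <- Cexp_plus; f_equal; ring.
Qed.

Lemma Rcpow_0 (t : R) : Rcpow t 0 = 1.
Proof. unfold Rcpow; rewrite Cmult_0_l; apply Cexp_0. Qed.

Lemma Rcpow_1 (t : R) : 0 < t -> Rcpow t 1 = t.
Proof.
  intros Ht; unfold Rcpow; rewrite Cmult_1_l; unfold Cexp; simpl.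
  rewrite exp_ln, cos_0, sin_0 by exact Ht.
  apply injective_projections; simpl; ring.
Qed.

Lemma Rcpow_mult (a b : R) (s : C) : 0 < a -> 0 < b ->
  Rcpow (a * b) s = (Rcpow a s * Rcpow b s)%C.
Proof.
  intros Ha Hb; unfold Rcpow; rewrite ln_mult, RtoC_plus by assumption.
  rewrite <- Cexp_plus; f_equal; ring.
Qed.

(** Convertible with the integrand of [Cgamma] and with the scalar factor in [Cesaro_pow]. *)
Definition gamma_kernel (s : C) (t : R) : C :=
  (RtoC (exp (- t)) * Rcpow t (s - 1))%C.

Lemma gamma_kernel_alt (s : C) (t : R) :
  gamma_kernel s t =
  (exp (- t) * (exp ((Re s - 1) * ln t) * cos (Im s * ln t)),
   exp (- t) * (exp ((Re s - 1) * ln t) * sin (Im s * ln t))).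
Proof.
  unfold gamma_kernel, Rcpow, Cexp; destruct s as [x y].
  replace (Re (((x, y) - 1) * RtoC (ln t))) with ((x - 1) * ln t)
    by (simpl; ring).
  replace (Im (((x, y) - 1) * RtoC (ln t))) with (y * ln t) by (simpl; ring).
  apply injective_projections; simpl; ring.
Qed.

Lemma Cmod_gamma_kernel (s : C) (t : R) :
  Cmod (gamma_kernel s t) = exp (- t) * exp ((Re s - 1) * ln t).
Proof.
  rewrite gamma_kernel_alt; unfold Cmod; simpl fst; simpl snd.
  set (E := exp (- t)); set (F := exp ((Re s - 1) * ln t)); set (th := Im s * ln t).
  assert (H := sin2_cos2 th); unfold Rsqr in H.
  replace ((E * (F * cos th)) ^ 2 + (E * (F * sin th)) ^ 2)
    with ((E * F) ^ 2 * (sin th * sin th + cos th * cos th)) by ring.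
  rewrite H, Rmult_1_r; apply sqrt_pow2.
  left; apply Rmult_lt_0_compat; apply exp_pos.
Qed.

Lemma norm_C_R (z : C) : norm (V := C_R_NormedModule) z = Cmod z.
Proof.
  unfold norm; simpl; unfold prod_norm, Cmod; simpl.
  unfold norm; simpl; unfold abs; simpl.
  f_equal; rewrite !Rmult_1_r, <- !Rabs_mult, !Rabs_pos_eq by nra; ring.
Qed.

Lemma is_derive_C (u v : R -> R) (t du dv : R) :
  is_derive u t du -> is_derive v t dv ->
  is_derive (V := C_R_NormedModule) (fun t => (u t, v t) : C) t (du, dv).
Proof.
  intros Hu Hv.
  exact (filterdiff_comp'_2 (K := R_AbsRing) (T := R_NormedModule)
    (U := R_NormedModule) (V := R_NormedModule) (W := C_R_NormedModule)
    u v (fun a b => (a, b)) t _ _ (fun a b => (a, b)) Hu Hv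
    (filterdiff_ext _ _ (fun z => (fst z, snd z))
       (fun z => eq_refl)
       (filterdiff_linear (K := R_AbsRing) _
          (is_linear_prod (K := R_AbsRing) _ _ is_linear_fst is_linear_snd)))).
Qed.

Lemma exp_ln_minus_1 (a t : R) : 0 < t -> exp ((a - 1) * ln t) = exp (a * ln t) / t.
Proof.
  intros Ht; replace ((a - 1) * ln t) with (a * ln t + - ln t) by ring.
  rewrite exp_plus, exp_Ropp, exp_ln by exact Ht; reflexivity.
Qed.

(** The product rule, with [t^(s-2)] expressed through the kernel at [s - 1]; in this form,
    integration yields the functional equation. *)
Lemma is_derive_gamma_kernel (s : C) (t : R) : 0 < t ->
  is_derive (V := C_R_NormedModule) (gamma_kernel s) t
    ((s - 1) * gamma_kernel (s - 1) t - gamma_kernel s t)%C.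
Proof.
  intros Ht.
  apply (is_derive_ext (V := C_R_NormedModule) (fun t => _) _ _ _
           (fun t => eq_sym (gamma_kernel_alt s t))).
  replace ((s - 1) * gamma_kernel (s - 1) t - gamma_kernel s t)%C
    with (- (exp (- t) * (exp ((Re s - 1) * ln t) * cos (Im s * ln t)))
          + exp (- t) * ((Re s - 1) * / t * exp ((Re s - 1) * ln t) * cos (Im s * ln t)
              - exp ((Re s - 1) * ln t) * (Im s * / t * sin (Im s * ln t))),
          - (exp (- t) * (exp ((Re s - 1) * ln t) * sin (Im s * ln t)))
          + exp (- t) * ((Re s - 1) * / t * exp ((Re s - 1) * ln t) * sin (Im s * ln t)
              + exp ((Re s - 1) * ln t) * (Im s * / t * cos (Im s * ln t)))).
  - apply is_derive_C; auto_derive; auto; unfold one; simpl; ring.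
  - rewrite !gamma_kernel_alt; destruct s as [x y].
    replace (Re ((x, y) - 1) - 1) with (x - 1 - 1) by (simpl; ring).
    replace (Im ((x, y) - 1)) with y by (simpl; ring).
    rewrite (exp_ln_minus_1 (x - 1) t Ht); simpl.
    apply injective_projections; simpl; field; lra.
Qed.

Lemma continuous_gamma_kernel (s : C) (t : R) : 0 < t ->
  continuous (U := C_R_NormedModule) (gamma_kernel s) t.
Proof.
  intros Ht; apply (ex_derive_continuous (V := C_R_NormedModule)).
  eexists; exact (is_derive_gamma_kernel s t Ht).
Qed.

Lemma ln_le_sub_1 (u : R) : 0 < u -> ln u <= u - 1.
Proof.
  intros Hu; assert (H := exp_ineq1_le (ln u)); rewrite exp_ln in H by exact Hu; lra.
Qed.

(** The bound [ln u <= u - 1] at [u = t / (4 x)], the scale at which the slope in [t] is exactly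
    [1 / 4]. The square of this growth is then absorbed by [exp (- t / 2)]. *)
Lemma exp_ln_le (x t : R) : 0 < x -> 0 < t ->
  exp (x * ln t) <= exp (x * ln (4 * x)) * exp (t / 4).
Proof.
  intros Hx Ht; rewrite <- exp_plus.
  assert (H : x * ln t <= x * ln (4 * x) + t / 4).
  { assert (Hu : 0 < t / (4 * x)) by (apply Rdiv_lt_0_compat; lra).
    assert (H := ln_le_sub_1 _ Hu).
    replace (ln t) with (ln (t / (4 * x)) + ln (4 * x)).
    - replace (t / 4) with (x * (t / (4 * x))) by (field; lra); nra.
    - rewrite <- ln_mult by lra; f_equal; field; lra. }
  destruct H as [H | H]; [left; apply exp_increasing, H | rewrite H; lra].
Qed.

Lemma exp_le_exp (a b : R) : a <= b -> exp a <= exp b.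
Proof. intros [H | ->]; [left; apply exp_increasing, H | lra]. Qed.

Lemma filterlim_R_0 {T : Type} (F : (T -> Prop) -> Prop) (f : T -> R) : Filter F ->
  (forall eps, 0 < eps -> F (fun t => Rabs (f t) < eps)) -> filterlim f F (locally 0).
Proof.
  intros HF H; apply (filterlim_locally (F := F) f 0); intros eps.
  generalize (H eps (cond_pos eps)); apply filter_imp; intros t Ht.
  change (Rabs (f t - 0) < eps); rewrite Rminus_0_r; exact Ht.
Qed.

Lemma filterlim_exp_ln_at_0 (x : R) : 0 < x ->
  filterlim (fun t => exp (x * ln t)) (at_right 0) (locally 0).
Proof.
  intros Hx; apply filterlim_R_0; [typeclasses eauto | intros eps He].
  exists (mkposreal _ (exp_pos (ln eps / x))); intros t Ht Ht0.
  change (Rabs (t - 0) < exp (ln eps / x)) in Ht; apply Rabs_def2 in Ht.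
  rewrite Rabs_pos_eq by (left; apply exp_pos).
  rewrite <- (exp_ln eps) by exact He; apply exp_increasing.
  assert (H : ln t < ln eps / x) by (rewrite <- (ln_exp (ln eps / x)); apply ln_increasing; lra).
  apply Rmult_lt_compat_l with (r := x) in H; [ | exact Hx].
  replace (x * (ln eps / x)) with (ln eps) in H by (field; lra); exact H.
Qed.

Lemma filterlim_exp_ln_at_infty (x : R) : 0 < x ->
  filterlim (fun t => exp (- (x * ln t))) (Rbar_locally p_infty) (locally 0).
Proof.
  intros Hx; apply filterlim_R_0; [typeclasses eauto | intros eps He].
  exists (exp (- ln eps / x)); intros t Ht.
  rewrite Rabs_pos_eq by (left; apply exp_pos).
  rewrite <- (exp_ln eps) by exact He; apply exp_increasing.
  assert (H : - ln eps / x < ln t)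
    by (rewrite <- (ln_exp (- ln eps / x)); apply ln_increasing; [apply exp_pos | exact Ht]).
  apply Rmult_lt_compat_l with (r := x) in H; [ | exact Hx].
  replace (x * (- ln eps / x)) with (- ln eps) in H by (field; lra); lra.
Qed.

(* [t^x / (1 + t^x)] increases from 0 to 1, and its derivative dominates a
   multiple of [exp (- t / 2) t^(x - 1)]. *)
Lemma ex_RInt_pos_gamma {V : CompleteNormedModule R_AbsRing} (f : R -> V) (x : R) :
  0 < x -> (forall t, 0 < t -> continuous f t) ->
  (forall t, 0 < t -> norm (f t) <= exp (- (t / 2)) * exp ((x - 1) * ln t)) ->
  exists l : V, is_RInt_pos f l.
Proof.
  intros Hx Hf Hfx.
  (* [M] bounds [(1 + t^x) exp (- t / 4)]; its square enters because the derivative of [u / (1 + u)]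
     has a squared denominator, and [/ x] cancels the factor from differentiating [t^x]. *)
  set (M := 1 + exp (x * ln (4 * x))).
  set (K := M ^ 2 / x).
  assert (Hc : forall c, 0 <= c -> continuous (fun u => K * (u / (1 + u))) c).
  { intros c Hc; apply (ex_derive_continuous (V := R_NormedModule)); auto_derive; lra. }
  apply (ex_RInt_pos_dominated f
    (fun t => K * (x * / t * exp (x * ln t) / (1 + exp (x * ln t)) ^ 2))
    (fun t => K * (exp (x * ln t) / (1 + exp (x * ln t)))) 0 K Hf).
  - intros t Ht; eapply Rle_trans; [apply Hfx, Ht | ].
    rewrite exp_ln_minus_1 by exact Ht.
    assert (HT := exp_pos (x * ln t)).
    assert (HTb := exp_ln_le x t Hx Ht).
    set (T := exp (x * ln t)) in *.
    assert (HM : (1 + T) * exp (- (t / 4)) <= M).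
    { assert (He : exp (t / 4) * exp (- (t / 4)) = 1)
        by (rewrite <- exp_plus, Rplus_opp_r; apply exp_0).
      assert (H1 : exp (- (t / 4)) <= 1) by (rewrite <- exp_0; apply exp_le_exp; lra).
      assert (H2 := exp_pos (- (t / 4))).
      assert (H3 : T * exp (- (t / 4)) <= exp (x * ln (4 * x))).
      { replace (exp (x * ln (4 * x)))
          with (exp (x * ln (4 * x)) * exp (t / 4) * exp (- (t / 4)))
          by (rewrite Rmult_assoc, He; ring).
        apply Rmult_le_compat_r; [left; exact H2 | exact HTb]. }
      unfold M; lra. }
    assert (HM2 : exp (- (t / 2)) * (1 + T) ^ 2 <= M ^ 2).
    { replace (- (t / 2)) with (- (t / 4) + - (t / 4)) by field.
      rewrite exp_plus.
      replace (exp (- (t / 4)) * exp (- (t / 4)) * (1 + T) ^ 2)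
        with (((1 + T) * exp (- (t / 4))) ^ 2) by ring.
      apply pow_incr; split; [ | exact HM].
      left; apply Rmult_lt_0_compat; [lra | apply exp_pos]. }
    replace (K * (x * / t * T / (1 + T) ^ 2))
      with (M ^ 2 * (T / t / (1 + T) ^ 2)) by (unfold K; field; lra).
    replace (exp (- (t / 2)) * (T / t))
      with (exp (- (t / 2)) * (1 + T) ^ 2 * (T / t / (1 + T) ^ 2)) by (field; lra).
    apply Rmult_le_compat_r; [ | exact HM2].
    left; apply Rdiv_lt_0_compat; [apply Rdiv_lt_0_compat; lra | ].
    apply pow_lt; lra.
  - intros t Ht; assert (HT := exp_pos (x * ln t)).
    auto_derive; [lra | field; lra].
  - intros t Ht; assert (HT := exp_pos (x * ln t)).
    apply (ex_derive_continuous (V := R_NormedModule)); auto_derive.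
    repeat split; auto; try lra; nra.
  - assert (H := Hc 0 (Rle_refl 0)); unfold continuous in H.
    replace (K * (0 / (1 + 0))) with 0 in H by field.
    exact (filterlim_comp _ _ _ _ _ _ _ _ (filterlim_exp_ln_at_0 x Hx) H).
  (* At infinity the antiderivative is rewritten as [K / (1 + t^(-x))], with [t^(-x)] tending to
     0. *)
  - assert (H : filterlim (fun u => K * / (1 + u)) (locally 0) (locally (K * / (1 + 0)))).
    { apply (ex_derive_continuous (V := R_NormedModule) (fun u => K * / (1 + u))).
      auto_derive; lra. }
    replace (K * / (1 + 0)) with K in H by field.
    apply (filterlim_ext (fun t => K * / (1 + exp (- (x * ln t))))).
    + intros t; rewrite exp_Ropp; assert (HT := exp_pos (x * ln t)); field; lra.
    + exact (filterlim_comp _ _ _ _ _ _ _ _ (filterlim_exp_ln_at_infty x Hx) H).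
Qed.

(** Half of the decay is given away so that the convergence criterion shared with the [H2]-valued
    integral applies. *)
Lemma gamma_kernel_bound (s : C) (t : R) : 0 < t ->
  Cmod (gamma_kernel s t) <= exp (- (t / 2)) * exp ((Re s - 1) * ln t).
Proof.
  intros Ht; rewrite Cmod_gamma_kernel.
  apply Rmult_le_compat_r; [left; apply exp_pos | apply exp_le_exp; lra].
Qed.

Lemma is_RInt_pos_Cgamma (s : C) : 0 < Re s ->
  is_RInt_gen (V := C_R_NormedModule) (gamma_kernel s)
    (at_right 0) (Rbar_locally p_infty) (Cgamma s).
Proof.
  intros Hs; apply (RInt_gen_correct (V := C_R_CompleteNormedModule)).
  apply (ex_RInt_pos_gamma (V := C_R_CompleteNormedModule) _ (Re s) Hs).
  - intros t; exact (continuous_gamma_kernel s t).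
  - intros t Ht; refine (Rle_trans _ _ _ _ (gamma_kernel_bound s t Ht)).
    apply Req_le, norm_C_R.
Qed.

Lemma is_linear_Cmult (c : C) :
  is_linear (U := C_R_NormedModule) (V := C_R_NormedModule) (fun z => (c * z)%C).
Proof.
  apply Build_is_linear.
  - intros z w; exact (Cmult_plus_distr_l c z w).
  - intros k z; apply injective_projections; unfold scal; simpl;
      unfold prod_scal, scal; simpl; unfold mult; simpl; ring.
  - exists (Cmod c + 1); assert (H := Cmod_ge_0 c); split; [lra | ].
    intros z; rewrite !norm_C_R, Cmod_mult; apply Rmult_le_compat_r; [apply Cmod_ge_0 | lra].
Qed.

Lemma is_RInt_pos_gamma_rate (s : C) (m : R) : 0 < Re s -> 0 < m ->
  is_RInt_gen (V := C_R_NormedModule)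
    (fun t => RtoC (exp (- (m * t))) * Rcpow t (s - 1))%C
    (at_right 0) (Rbar_locally p_infty) (Rcpow m (- s) * Cgamma s)%C.
Proof.
  intros Hs Hm.
  assert (H := is_RInt_pos_dilate (V := C_R_NormedModule) _ _ m Hm (is_RInt_pos_Cgamma s Hs)).
  apply (is_RInt_gen_linear (U := C_R_NormedModule) (V := C_R_NormedModule) _ _ _ _ _
           _ _ (is_linear_Cmult (Rcpow m (- s)))) in H.
  revert H; apply (is_RInt_pos_ext (V := C_R_NormedModule)); intros t Ht.
  unfold gamma_kernel; rewrite Rcpow_mult by assumption.
  (* Dilation by [m] brings out [m * m^(s-1)], which the prefactor [m^(-s)] cancels. *)
  assert (E : (Rcpow m (- s) * (RtoC m * Rcpow m (s - 1)) = 1)%C).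
  { rewrite <- (Rcpow_1 m Hm), <- !Rcpow_plus.
    replace (- s + (1 + (s - 1)))%C with (RtoC 0) by ring; apply Rcpow_0. }
  transitivity (Rcpow m (- s) * (RtoC m * Rcpow m (s - 1))
                * (RtoC (exp (- (m * t))) * Rcpow t (s - 1)))%C.
  - apply injective_projections; unfold scal; simpl;
      unfold prod_scal, scal; simpl; unfold mult; simpl; ring.
  - rewrite E; ring_in C.
Qed.

(** * Gamma has no zero in the right half-plane *)

Lemma gamma_kernel_lim_0 (s : C) : 1 < Re s ->
  filterlim (gamma_kernel s) (at_right 0)
    (locally (T := C_R_NormedModule) (RtoC 0)).
Proof.
  intros Hs; apply (filterlim_norm_zero (V := C_R_NormedModule)).
  apply filterlim_R_0; [typeclasses eauto | intros eps He].
  assert (HT := filterlim_exp_ln_at_0 (Re s - 1) ltac:(lra)).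
  generalize (filter_and _ _ at_right_0_pos
    (proj1 (filterlim_locally _ 0) HT (mkposreal _ He))).
  apply filter_imp; intros t [Ht HTt].
  change (Rabs (exp ((Re s - 1) * ln t) - 0) < eps) in HTt.
  rewrite Rminus_0_r in HTt; rewrite norm_C_R, Cmod_gamma_kernel.
  rewrite Rabs_mult; refine (Rle_lt_trans _ _ _ _ HTt).
  rewrite <- (Rmult_1_l (Rabs (exp ((Re s - 1) * ln t)))) at 2.
  apply Rmult_le_compat_r; [apply Rabs_pos | ].
  rewrite Rabs_pos_eq by (left; apply exp_pos).
  rewrite <- exp_0; apply exp_le_exp; lra.
Qed.

Lemma gamma_kernel_lim_infty (s : C) : 1 < Re s ->
  filterlim (gamma_kernel s) (Rbar_locally p_infty)
    (locally (T := C_R_NormedModule) (RtoC 0)).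
Proof.
  intros Hs; apply (filterlim_norm_zero (V := C_R_NormedModule)).
  apply filterlim_R_0; [typeclasses eauto | intros eps He].
  set (K := exp ((Re s - 1) * ln (4 * (Re s - 1)))).
  assert (HK : 0 < K) by apply exp_pos.
  (* Beyond [2 ln (K / eps)] the bound [K exp (- t / 2)] is below [eps]. *)
  generalize (filter_and _ _ (p_infty_gt 0) (p_infty_gt (2 * ln (K / eps)))).
  apply filter_imp; intros t [Ht HtK].
  rewrite norm_C_R, Rabs_pos_eq, Cmod_gamma_kernel by apply Cmod_ge_0.
  assert (H1 : exp ((Re s - 1) * ln t) <= K * exp (t / 4))
    by (apply exp_ln_le; [lra | exact Ht]).
  apply Rle_lt_trans with (exp (- t) * (K * exp (t / 4))).
  { apply Rmult_le_compat_l; [left; apply exp_pos | exact H1]. }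
  replace (exp (- t) * (K * exp (t / 4))) with (K * exp (- t + t / 4))
    by (rewrite exp_plus; ring).
  apply Rle_lt_trans with (K * exp (- (t / 2))).
  { apply Rmult_le_compat_l; [lra | apply exp_le_exp; lra]. }
  assert (H2 : K / eps < exp (t / 2)).
  { rewrite <- (exp_ln (K / eps)) by (apply Rdiv_lt_0_compat; assumption).
    apply exp_increasing; lra. }
  rewrite exp_Ropp; assert (H3 := exp_pos (t / 2)).
  apply Rmult_lt_reg_r with (exp (t / 2)); [exact H3 | ].
  rewrite Rmult_assoc, Rinv_l, Rmult_1_r by lra.
  apply Rmult_lt_compat_r with (r := eps) in H2; [ | exact He].
  unfold Rdiv in H2; rewrite Rmult_assoc, Rinv_l, Rmult_1_r in H2 by lra; lra.
Qed.

(** Integration by parts: the derivative of the kernel at [s + 1] is [s] times the kernel at [s]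
    minus the kernel at [s + 1], and its integral is 0 since both boundary terms vanish. *)
Lemma is_RInt_pos_gamma_succ (s : C) (l : C) : 0 < Re s ->
  is_RInt_gen (V := C_R_NormedModule) (gamma_kernel s)
    (at_right 0) (Rbar_locally p_infty) l ->
  is_RInt_gen (V := C_R_NormedModule) (gamma_kernel (s + 1))
    (at_right 0) (Rbar_locally p_infty) (s * l)%C.
Proof.
  intros Hs Hl.
  assert (Hs1 : 1 < Re (s + 1)) by (unfold Re in *; simpl; lra).
  assert (Es : (s + 1 - 1 = s)%C) by ring.
  assert (H1 := is_RInt_gen_linear (U := C_R_NormedModule) (V := C_R_NormedModule)
                  _ _ _ _ l _ _ (is_linear_Cmult s) Hl).
  assert (Hd : forall t, 0 < t -> is_derive (V := C_R_NormedModule)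
    (gamma_kernel (s + 1)) t (s * gamma_kernel s t - gamma_kernel (s + 1) t)%C).
  { intros t Ht; assert (H := is_derive_gamma_kernel (s + 1) t Ht).
    rewrite Es in H; exact H. }
  assert (Hc : forall t, 0 < t -> continuous (U := C_R_NormedModule)
    (fun t => s * gamma_kernel s t - gamma_kernel (s + 1) t)%C t).
  { intros t Ht; apply (continuous_minus (V := C_R_NormedModule));
      [ | apply continuous_gamma_kernel, Ht].
    apply (continuous_comp (V := C_R_NormedModule) (W := C_R_NormedModule)
             (gamma_kernel s) (fun z => s * z)%C);
      [apply continuous_gamma_kernel, Ht | apply linear_cont, is_linear_Cmult]. }
  assert (H2 := is_RInt_pos_derive (V := C_R_CompleteNormedModule) _ _ _ _ Hd Hc
                  (gamma_kernel_lim_0 _ Hs1) (gamma_kernel_lim_infty _ Hs1)).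
  assert (H3 := is_RInt_gen_minus (V := C_R_NormedModule) _ _ _ _ H1 H2).
  replace (s * l)%C with (minus (G := C_R_NormedModule) (s * l)%C
    (minus (G := C_R_NormedModule) (RtoC 0) (RtoC 0))).
  - revert H3; apply (is_RInt_pos_ext (V := C_R_NormedModule)).
    intros t _; apply injective_projections; unfold minus, plus, opp; simpl;
      unfold prod_plus, prod_opp, plus, opp; simpl; unfold plus, opp; simpl; ring.
  - apply injective_projections; unfold minus, plus, opp; simpl;
      unfold prod_plus, prod_opp, plus, opp; simpl; unfold plus, opp; simpl; ring.
Qed.

Lemma Cgamma_unique (s l : C) :
  is_RInt_gen (V := C_R_NormedModule) (gamma_kernel s)
    (at_right 0) (Rbar_locally p_infty) l ->
  Cgamma s = l.
Proof. exact (is_RInt_gen_unique (V := C_R_CompleteNormedModule) _ _). Qed.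

Lemma Cgamma_succ (s : C) : 0 < Re s -> Cgamma (s + 1) = (s * Cgamma s)%C.
Proof.
  intros Hs; apply Cgamma_unique, is_RInt_pos_gamma_succ; [exact Hs | ].
  apply is_RInt_pos_Cgamma, Hs.
Qed.

Lemma is_RInt_pos_Re (f : R -> C) (l : C) :
  is_RInt_gen (V := C_R_NormedModule) f (at_right 0) (Rbar_locally p_infty) l ->
  is_RInt_pos (fun t => Re (f t)) (Re l).
Proof.
  exact (is_RInt_gen_linear (U := C_R_NormedModule) (V := R_NormedModule)
           fst f _ _ l _ _ is_linear_fst).
Qed.

Definition Rgamma_kernel (a t : R) : R := exp (- t) * exp ((a - 1) * ln t).

Lemma is_RInt_pos_Rgamma (a : R) : 0 < a ->
  is_RInt_pos (Rgamma_kernel a) (Re (Cgamma (RtoC a))).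
Proof.
  intros Ha; generalize (is_RInt_pos_Re _ _ (is_RInt_pos_Cgamma (RtoC a) Ha)).
  apply (is_RInt_pos_ext (V := R_NormedModule)); intros t _.
  rewrite gamma_kernel_alt; unfold Rgamma_kernel; simpl.
  rewrite Rmult_0_l, cos_0; ring.
Qed.

Lemma Rgamma_succ (a : R) : 0 < a ->
  Re (Cgamma (RtoC (a + 1))) = a * Re (Cgamma (RtoC a)).
Proof.
  intros Ha; rewrite RtoC_plus, Cgamma_succ by exact Ha; simpl; ring.
Qed.

Lemma Rgamma_pos (a : R) : 1 <= a -> 0 < Re (Cgamma (RtoC a)).
Proof.
  intros Ha.
  (* On [(1, 2)] one has [t^(a-1) >= 1], as [1 <= a], and [exp (- t) >= exp (- 2)]. *)
  apply (is_RInt_pos_gt_0 (Rgamma_kernel a) _ (exp (- 2))).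
  - intros t Ht; apply (ex_derive_continuous (V := R_NormedModule)).
    unfold Rgamma_kernel; auto_derive; exact Ht.
  - intros t Ht; left; apply Rmult_lt_0_compat; apply exp_pos.
  - apply exp_pos.
  - intros t Ht; unfold Rgamma_kernel; rewrite <- exp_plus; apply exp_le_exp.
    assert (H : 0 < ln t) by (rewrite <- ln_1; apply ln_increasing; lra).
    assert (0 <= (a - 1) * ln t) by (apply Rmult_le_pos; lra); lra.
  - apply is_RInt_pos_Rgamma; lra.
Qed.

Lemma sin_sq_le (z : R) : sin z ^ 2 <= z ^ 2.
Proof.
  assert (Hpos : forall y, 0 < y -> sin y ^ 2 <= y ^ 2).
  { intros y Hy; destruct (Rle_lt_dec 1 y) as [H1 | H1].
    - assert (H := SIN_bound y); nra.
    - assert (H := sin_lt_x y Hy).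
      assert (Hpi := PI2_1).
      assert (H0 : 0 <= sin y) by (apply sin_ge_0; lra); nra. }
  destruct (Rtotal_order z 0) as [Hz | [-> | Hz]]; [ | rewrite sin_0; lra | auto].
  assert (H := Hpos (- z) ltac:(lra)); rewrite sin_neg in H; nra.
Qed.

Lemma cos_ge_quadratic (th : R) : 1 - th ^ 2 / 2 <= cos th.
Proof.
  replace th with (2 * (th / 2)) at 2 by field.
  rewrite cos_2a_sin; assert (H := sin_sq_le (th / 2)); nra.
Qed.

(** With [h = ln v / 2] the bracket is [(exp h - exp (- h))^2], which is at least [h^2]. The bracket
    is a combination of [v], 1 and [1 / v], so that against the Gamma density it integrates to
    values of Gamma at [N + 1], [N] and [N - 1]. *)
Lemma ln_sq_le (v : R) : 0 < v -> ln v ^ 2 <= 4 * (v - 2 + / v).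
Proof.
  intros Hv; set (h := ln v / 2).
  assert (Ev : v = exp h * exp h).
  { rewrite <- exp_plus; unfold h.
    replace (ln v / 2 + ln v / 2) with (ln v) by field; rewrite exp_ln; auto. }
  assert (Eh : exp h * exp (- h) = 1) by (rewrite <- exp_plus, Rplus_opp_r; apply exp_0).
  assert (Hp := exp_pos h); assert (Hm := exp_pos (- h)).
  assert (Eiv : / v = exp (- h) * exp (- h)).
  { rewrite Ev, exp_Ropp; field; lra. }
  assert (E : v - 2 + / v = (exp h - exp (- h)) ^ 2).
  { rewrite Eiv, Ev; replace 2 with (2 * (exp h * exp (- h))) by lra; ring. }
  rewrite E; replace (ln v) with (2 * h) by (unfold h; field).
  assert (Hh : h ^ 2 <= (exp h - exp (- h)) ^ 2).
  { assert (H1 := exp_ineq1_le h); assert (H2 := exp_ineq1_le (- h)).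
    destruct (Rle_lt_dec 0 h) as [H0 | H0].
    - assert (exp (- h) <= 1) by (rewrite <- exp_0; apply exp_le_exp; lra); nra.
    - assert (exp h <= 1) by (rewrite <- exp_0; apply exp_le_exp; lra); nra. }
  nra.
Qed.

Lemma is_RInt_pos_gamma_shift_0 (s : C) (n : nat) : 0 < Re s ->
  is_RInt_gen (V := C_R_NormedModule) (gamma_kernel s)
    (at_right 0) (Rbar_locally p_infty) (RtoC 0) ->
  is_RInt_gen (V := C_R_NormedModule) (gamma_kernel (s + RtoC (INR n)))
    (at_right 0) (Rbar_locally p_infty) (RtoC 0).
Proof.
  intros Hs H0; induction n as [ | n IH].
  - simpl INR; rewrite Cplus_0_r; exact H0.
  - rewrite S_INR, RtoC_plus, Cplus_assoc.
    rewrite <- (Cmult_0_r (s + RtoC (INR n))).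
    apply is_RInt_pos_gamma_succ; [ | exact IH].
    assert (H := pos_INR n); unfold Re in *; simpl; lra.
Qed.

(** The constant multiplying the kernel is [N^(- i y)]: it turns the phase [y ln t] into
    [y ln (t / N)], which vanishes at [t = N]. The left side is the density times
    [1 - 2 y^2 (v - 2 + 1 / v)], with [t] and [1 / t] absorbed into the neighbouring kernels. *)
Lemma gamma_kernel_Re_ge (s : C) (N y t : R) :
  0 < N -> 0 < t -> Re s = N -> Im s = y ->
  (1 + 4 * y ^ 2) * Rgamma_kernel N t
  - (2 * y ^ 2 / N * Rgamma_kernel (N + 1) t
     + 2 * y ^ 2 * N * Rgamma_kernel (N - 1) t)
  <= Re ((cos (y * ln N), - sin (y * ln N)) * gamma_kernel s t).
Proof.
  intros HN Ht HRe HIm.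
  rewrite gamma_kernel_alt, HRe, HIm; unfold Rgamma_kernel.
  rewrite (exp_ln_minus_1 (N - 1) t Ht).
  replace ((N + 1 - 1) * ln t) with ((N - 1) * ln t + ln t) by ring.
  rewrite !exp_plus, exp_ln by exact Ht.
  set (u := exp (- t) * exp ((N - 1) * ln t)).
  assert (Hu : 0 < u) by (apply Rmult_lt_0_compat; apply exp_pos).
  replace (Re _) with (u * cos (y * ln t - y * ln N))
    by (rewrite cos_minus; unfold u, Re; simpl; ring).
  replace ((1 + 4 * y ^ 2) * u - _)
    with (u * (1 - 2 * y ^ 2 * (t / N - 2 + / (t / N))))
    by (unfold u; field; lra).
  apply Rmult_le_compat_l; [lra | ].
  eapply Rle_trans; [ | apply cos_ge_quadratic].
  assert (Hv : 0 < t / N) by (apply Rdiv_lt_0_compat; lra).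
  assert (Hl := ln_sq_le (t / N) Hv).
  replace (ln (t / N)) with (ln t - ln N) in Hl.
  2:{ unfold Rdiv; rewrite ln_mult, ln_Rinv; try apply Rinv_0_lt_compat; lra. }
  replace ((y * ln t - y * ln N) ^ 2) with (y ^ 2 * (ln t - ln N) ^ 2) by ring.
  apply Rmult_le_compat_l with (r := y ^ 2) in Hl; [lra | apply pow2_ge_0].
Qed.

(* If Gamma vanished at [s = x + i y], then by the functional equation it would
   vanish at every [N + i y] with [N = x + n]. But for large [N] the density
   [exp (- t) t^(N - 1)] concentrates around [t = N] on the logarithmic scale,
   so that [t^(i y)] is nearly constant: with [v = t / N],
   [cos (y ln v) >= 1 - 2 y^2 (v - 2 + 1 / v)], whose integral is
   [Gamma(N) (1 - 2 y^2 / (N - 1))]. *)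
Lemma Cgamma_neq_0 (s : C) : 0 < Re s -> Cgamma s <> RtoC 0.
Proof.
  intros Hs H0; assert (Hint := is_RInt_pos_Cgamma s Hs); rewrite H0 in Hint.
  set (y := Im s).
  (* The margin 2 gives both [N - 1 > 2 y^2] for the contradiction and [N - 1 >= 1] for the
     positivity of Gamma there. *)
  destruct (nfloor_ex (2 * y ^ 2 + 2)) as [n [_ Hn]]; [nra | ].
  set (N := Re s + INR (S n)).
  assert (HIm : Im (s + RtoC (INR (S n))) = y) by (unfold y, Im; simpl; ring).
  assert (HN : 2 * y ^ 2 + 2 < N) by (unfold N; rewrite S_INR; lra).
  assert (Hy : 0 <= y ^ 2) by apply pow2_ge_0.
  assert (HI := is_RInt_pos_gamma_shift_0 s (S n) Hs Hint).
  apply (is_RInt_gen_linear (U := C_R_NormedModule) (V := C_R_NormedModule) _ _ _ _ _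
           _ _ (is_linear_Cmult (cos (y * ln N), - sin (y * ln N)))) in HI.
  apply is_RInt_pos_Re in HI; rewrite Cmult_0_r in HI.
  assert (H1 := is_RInt_pos_Rgamma N ltac:(lra)).
  assert (H2 := is_RInt_pos_Rgamma (N + 1) ltac:(lra)).
  assert (H3 := is_RInt_pos_Rgamma (N - 1) ltac:(lra)).
  rewrite (Rgamma_succ N) in H2 by lra.
  assert (EN := Rgamma_succ (N - 1) ltac:(lra)).
  replace (N - 1 + 1) with N in EN by ring; rewrite EN in H1, H2.
  assert (Hpos := Rgamma_pos (N - 1) ltac:(lra)).
  set (g := Re (Cgamma (RtoC (N - 1)))) in *.
  assert (Hk := is_RInt_gen_minus (V := R_NormedModule) _ _ _ _
    (is_RInt_gen_scal (V := R_NormedModule) _ (1 + 4 * y ^ 2) _ H1)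
    (is_RInt_gen_plus (V := R_NormedModule) _ _ _ _
       (is_RInt_gen_scal (V := R_NormedModule) _ (2 * y ^ 2 / N) _ H2)
       (is_RInt_gen_scal (V := R_NormedModule) _ (2 * y ^ 2 * N) _ H3))).
  assert (Hle := fun H => is_RInt_pos_le _ _ _ _ H Hk HI).
  specialize (Hle (fun t Ht => gamma_kernel_Re_ge (s + RtoC (INR (S n))) N y t
                                 ltac:(lra) Ht eq_refl HIm)).
  change ((1 + 4 * y ^ 2) * ((N - 1) * g)
          - (2 * y ^ 2 / N * (N * ((N - 1) * g)) + 2 * y ^ 2 * N * g) <= 0) in Hle.
  replace (2 * y ^ 2 / N * (N * ((N - 1) * g))) with (2 * y ^ 2 * ((N - 1) * g))
    in Hle by (field; lra).
  (* This product is the left side of [Hle] once expanded. *)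
  assert (H : 0 < g * (N - 1 - 2 * y ^ 2)) by (apply Rmult_lt_0_compat; lra).
  nra.
Qed.

(** * Integration in the Hardy space *)

Lemma is_linear_coef (n : nat) :
  is_linear (U := H2_NormedModule) (V := C_R_NormedModule) (fun f : H2 => coef f n).
Proof.
  apply Build_is_linear.
  - intros f g; reflexivity.
  - intros k f; apply injective_projections; unfold scal; simpl;
      unfold prod_scal, scal; simpl; unfold mult; simpl; ring.
  - exists 1; split; [lra | ]; intros f.
    rewrite norm_C_R, Rmult_1_l; apply coef_le_norm.
Qed.

Lemma continuous_Cmod_sub (u : R -> C) (t0 : R) :
  continuous (U := C_R_NormedModule) u t0 ->
  continuous (fun t => Cmod (u t - u t0)) t0.
Proof.
  intros Hu.
  apply (continuous_ext (fun t => norm (V := C_R_NormedModule)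
                                    (minus (G := C_R_NormedModule) (u t) (u t0)))).
  - intros t; apply norm_C_R.
  - apply (continuous_comp (U := R_UniformSpace) (V := C_R_NormedModule)).
    + apply (continuous_minus (V := C_R_NormedModule)); [exact Hu | apply continuous_const].
    + apply (filterlim_norm (V := C_R_NormedModule)).
Qed.

Lemma continuous_sum_n (u : nat -> R -> R) (N : nat) (t0 : R) :
  (forall n, continuous (u n) t0) -> continuous (fun t => sum_n (fun n => u n t) N) t0.
Proof.
  intros Hu; induction N as [ | N IH].
  - apply (continuous_ext (u 0%nat)); [intros t; rewrite sum_O; reflexivity | apply Hu].
  - apply (continuous_ext (fun t => sum_n (fun n => u n t) N + u (S N) t));
      [intros t; rewrite sum_n_RS; reflexivity | ].
    apply (continuous_plus (V := R_NormedModule)); [exact IH | apply Hu].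
Qed.

(** Dominated convergence in l^2: finitely many coefficients are handled by continuity, and the
    squared difference of each later one is at most [4 D n ^ 2]. *)
Lemma H2_continuous_dominated (F : R -> H2) (D : nat -> R) (t0 : R) :
  ex_series (fun n => D n ^ 2) ->
  locally t0 (fun t => forall n, Cmod (coef (F t) n) <= D n) ->
  (forall n, continuous (U := C_R_NormedModule) (fun t => coef (F t) n) t0) ->
  continuous F t0.
Proof.
  intros HD Hdom Hcoef.
  apply (filterlim_locally (U := H2_UniformSpace)); intros eps.
  assert (Heps := cond_pos eps).
  (* The head costs [d] and the tail [4 d]; the total [eps^2 / 8] stays below [(eps / 2)^2]. *)
  set (d := eps ^ 2 / 40); assert (Hd : 0 < d) by (unfold d; nra).
  assert (Htail : exists N, Series (fun n => D n ^ 2) - sum_n (fun n => D n ^ 2) N < d).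
  { assert (H := Series_correct _ HD).
    destruct (filter_ex _ (proj1 (filterlim_locally _ _) H (mkposreal _ Hd))) as [N HN].
    change (Rabs (sum_n (fun n => D n ^ 2) N - Series (fun n => D n ^ 2)) < d) in HN.
    apply Rabs_def2 in HN; exists N; lra. }
  destruct Htail as [N HN].
  set (e := fun t n => Cmod (coef (F t) n - coef (F t0) n) ^ 2).
  assert (Hfin : locally t0 (fun t => sum_n (e t) N < d)).
  { assert (Hcont : continuous (fun t => sum_n (e t) N) t0).
    { apply (continuous_sum_n (fun n t => e t n)); intros n; unfold e; simpl.
      assert (H := continuous_Cmod_sub _ _ (Hcoef n)).
      apply (continuous_mult (K := R_AbsRing)); [exact H | ].
      apply (continuous_mult (K := R_AbsRing)); [exact H | apply continuous_const]. }
    assert (E0 : sum_n (e t0) N = 0).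
    { rewrite (sum_n_ext (e t0) (fun n => 0 * INR n)), sum_n_Rmult; [apply Rmult_0_l | ].
      intros n; unfold e; unfold Cminus; rewrite Cplus_opp_r, Cmod_0; simpl; ring. }
    apply (Hcont (fun x => x < d)), (open_lt d); rewrite E0; exact Hd. }
  generalize (filter_and _ _ Hfin Hdom); apply filter_imp; intros t [Ht Htdom].
  assert (Ht0dom := locally_singleton _ _ Hdom).
  change (H2_norm (minus (F t) (F t0)) < eps).
  apply Rle_lt_trans with (eps / 2); [ | lra].
  apply norm_le_of_sums; [lra | intros M].
  rewrite (sum_n_ext _ (e t)) by (intros n; rewrite coef_minus; reflexivity).
  assert (Hsum : forall m, sum_n (e t) m <= d
            + 4 * (sum_n (fun n => D n ^ 2) (Nat.max N m) - sum_n (fun n => D n ^ 2) N)).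
  { intros m.
    assert (He : forall n, 0 <= e t n) by (intros n; apply pow2_ge_0).
    apply Rle_trans with (sum_n (e t) (Nat.max N m));
      [apply sum_n_le_incr; [exact He | lia] | ].
    assert (HNm : (N <= Nat.max N m)%nat) by lia; revert HNm.
    generalize (Nat.max N m); induction 1 as [ | k _ IH]; [lra | ].
    rewrite !sum_n_RS.
    assert (H1 : e t (S k) <= 4 * D (S k) ^ 2); [ | lra].
    unfold e; specialize (Htdom (S k)); specialize (Ht0dom (S k)).
    assert (H2 := Cmod_triangle (coef (F t) (S k)) (- coef (F t0) (S k))).
    rewrite Cmod_opp in H2.
    assert (H3 := Cmod_ge_0 (coef (F t) (S k) - coef (F t0) (S k))).
    replace (4 * D (S k) ^ 2) with ((2 * D (S k)) ^ 2) by ring.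
    apply pow_incr; split; [exact H3 | unfold Cminus; lra]. }
  refine (Rle_trans _ _ _ (Hsum M) _).
  assert (H := sum_n_le_Series (fun n => D n ^ 2) (Nat.max N M)
                 (fun n => pow2_ge_0 _) HD).
  unfold d in *; simpl in *; nra.
Qed.

Lemma continuous_binom_weight (n j : nat) (t : R) :
  continuous (fun t => binom_weight (exp (- t)) n j) t.
Proof.
  assert (Hp : continuous (fun t => exp (- t)) t).
  { apply (ex_derive_continuous (V := R_NormedModule)); auto_derive; exact I. }
  assert (Hq : continuous (fun t => 1 - exp (- t)) t).
  { apply (ex_derive_continuous (V := R_NormedModule)); auto_derive; exact I. }
  revert j; induction n as [ | n IH]; intros [ | j]; simpl.
  - apply continuous_const.
  - apply continuous_const.
  - apply (continuous_mult (K := R_AbsRing)); [exact Hq | apply IH].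
  - apply (continuous_plus (V := R_NormedModule));
      apply (continuous_mult (K := R_AbsRing)); auto.
Qed.

(** In the closed form [p^j <= 1] and [(1 - p)^(n-j) <= (1 - q)^(n-j)]. This gives one
    square-summable majorant in [n] for all [p] above [q]. *)
Lemma binom_weight_le (p q : R) (n j : nat) : 0 < q <= p -> p <= 1 ->
  binom_weight p n j <= / q ^ j * binom_weight q n j.
Proof.
  intros Hq Hp; destruct (Nat.le_gt_cases j n) as [Hj | Hj].
  2:{ rewrite !binom_weight_gt by exact Hj; lra. }
  rewrite !binom_weight_closed by exact Hj.
  assert (Hqj : 0 < q ^ j) by (apply pow_lt; lra).
  replace (/ q ^ j * (Binomial.C n j * q ^ j * (1 - q) ^ (n - j)))
    with (Binomial.C n j * (1 - q) ^ (n - j)) by (field; lra).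
  assert (HC : 0 <= Binomial.C n j).
  { unfold Binomial.C; apply Rmult_le_pos; [apply pos_INR | ].
    left; apply Rinv_0_lt_compat, Rmult_lt_0_compat; apply INR_fact_lt_0. }
  rewrite Rmult_assoc; apply Rmult_le_compat_l; [exact HC | ].
  rewrite <- (Rmult_1_l ((1 - q) ^ (n - j))).
  apply Rmult_le_compat; try (apply pow_le; lra).
  - rewrite <- (pow1 j); apply pow_incr; lra.
  - apply pow_incr; lra.
Qed.

Definition Cesaro_integrand (beta : C) (j : nat) (t : R) : H2 :=
  H2_scal (gamma_kernel beta t) (adjoint (composition_op (phi t)) (H2_monomial j)).

Lemma coef_Cesaro_integrand (beta : C) (j : nat) (t : R) (n : nat) : 0 <= t ->
  coef (Cesaro_integrand beta j t) n
  = (gamma_kernel beta t * RtoC (binom_weight (exp (- t)) n j))%C.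
Proof.
  intros Ht; simpl; rewrite adjoint_phi_monomial by exact Ht; reflexivity.
Qed.

(** The weights lie in [[0, 1]], so the squares in row [j] sum to at most [1 / p = exp t]; the bound
    on the adjoint at [z^j] thus needs no operator norm. *)
Lemma norm_Cesaro_integrand (beta : C) (j : nat) (t : R) : 0 < t ->
  H2_norm (Cesaro_integrand beta j t)
  <= exp (- (t / 2)) * exp ((Re beta - 1) * ln t).
Proof.
  intros Ht; unfold Cesaro_integrand; rewrite H2_norm_scal, Cmod_gamma_kernel.
  assert (Hh : H2_norm (adjoint (composition_op (phi t)) (H2_monomial j)) <= exp (t / 2)).
  { apply norm_le_of_sums; [left; apply exp_pos | intros N].
    rewrite (sum_n_ext _ (fun n => Cmod (RtoC (binom_weight (exp (- t)) n j)) ^ 2))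
      by (intros n; rewrite adjoint_phi_monomial by lra; reflexivity).
    refine (Rle_trans _ _ _ (binom_weight_sq_sum _ j N (exp_opp_range t _)) _); [lra | ].
    rewrite <- exp_Ropp; simpl; rewrite Rmult_1_r, <- exp_plus.
    apply exp_le_exp; lra. }
  replace (- t) with (- (t / 2) + - (t / 2)) by field.
  rewrite exp_plus, exp_Ropp.
  assert (He := exp_pos (t / 2)); assert (Ha := exp_pos ((Re beta - 1) * ln t)).
  set (E := exp (t / 2)) in *; set (A := exp ((Re beta - 1) * ln t)) in *.
  set (h := H2_norm _) in *.
  replace (/ E * A) with (/ E * / E * A * E) by (field; lra).
  apply Rmult_le_compat_l; [ | exact Hh].
  assert (HE : 0 < / E) by (apply Rinv_0_lt_compat; exact He).
  left; repeat apply Rmult_lt_0_compat; assumption.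
Qed.

Lemma continuous_Cesaro_integrand (beta : C) (j : nat) (t0 : R) : 0 < t0 ->
  continuous (Cesaro_integrand beta j) t0.
Proof.
  intros Ht0.
  assert (Hnear : locally t0 (fun t => 0 < t < t0 + 1)).
  { apply (filter_and (fun t => 0 < t) (fun t => t < t0 + 1));
      [apply (open_gt 0), Ht0 | apply (open_lt (t0 + 1)); lra]. }
  (* A lower bound for [exp (- t)] throughout the neighbourhood [t < t0 + 1]. *)
  set (q := exp (- (t0 + 1))).
  set (K := Cmod (gamma_kernel beta t0) + 1).
  assert (Hq : 0 < q <= 1) by (apply exp_opp_range; lra).
  assert (Hqj : 0 < / q ^ j) by (apply Rinv_0_lt_compat, pow_lt, Hq).
  assert (Hgk : locally t0 (fun t => Cmod (gamma_kernel beta t) < K)).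
  { assert (H := continuous_Cmod_sub _ _ (continuous_gamma_kernel beta t0 Ht0)).
    assert (H1 : locally t0 (fun t => Cmod (gamma_kernel beta t - gamma_kernel beta t0) < 1)).
    { apply (H (fun x => x < 1)), (open_lt 1).
      unfold Cminus; rewrite Cplus_opp_r, Cmod_0; lra. }
    revert H1; apply filter_imp; intros t Ht.
    replace (gamma_kernel beta t)
      with (gamma_kernel beta t0 + (gamma_kernel beta t - gamma_kernel beta t0))%C by ring.
    eapply Rle_lt_trans; [apply Cmod_triangle | unfold K; lra]. }
  apply (H2_continuous_dominated _ (fun n => K * (/ q ^ j * binom_weight q n j))).
  - apply (ex_series_ext (fun n => (K * / q ^ j) ^ 2 * binom_weight q n j ^ 2)).
    { intros n; simpl; ring. }
    apply (ex_series_scal (V := R_NormedModule)).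
    apply ex_series_bounded with (/ q); [intros n; apply pow2_ge_0 | intros N].
    refine (Rle_trans _ _ _ _ (binom_weight_sq_sum q j N Hq)).
    apply Req_le, sum_n_ext; intros n; rewrite Cmod_R, <- !Rsqr_pow2; apply Rsqr_abs.
  - generalize (filter_and _ _ Hnear Hgk); apply filter_imp; intros t [Ht HtK] n.
    assert (Hp := exp_opp_range t ltac:(lra)).
    rewrite coef_Cesaro_integrand, Cmod_mult, Cmod_R by lra.
    rewrite Rabs_pos_eq by (apply binom_weight_ge_0; lra).
    apply Rmult_le_compat; [apply Cmod_ge_0 | apply binom_weight_ge_0; lra | lra | ].
    apply binom_weight_le; [ | lra].
    split; [lra | left; apply exp_increasing; lra].
  - intros n.
    assert (Hsc : continuous (U := C_R_NormedModule)
      (fun t => scal (V := C_R_NormedModule) (binom_weight (exp (- t)) n j)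
                  (gamma_kernel beta t)) t0).
    { apply (continuous_scal (V := C_R_NormedModule));
        [apply continuous_binom_weight | apply continuous_gamma_kernel, Ht0]. }
    refine (continuous_ext_loc _ _ _ _ Hsc).
    revert Hnear; apply filter_imp; intros t Ht.
    rewrite coef_Cesaro_integrand by lra.
    apply injective_projections; unfold scal; simpl;
      unfold prod_scal, scal; simpl; unfold mult; simpl; ring.
Qed.

(** * Matrix entries as finite combinations of Gamma integrals *)

Lemma is_RInt_pos_sum_n (f : nat -> R -> C) (l : nat -> C) (N : nat) :
  (forall k, is_RInt_gen (V := C_R_NormedModule) (f k)
               (at_right 0) (Rbar_locally p_infty) (l k)) ->
  is_RInt_gen (V := C_R_NormedModule) (fun t => sum_n (fun k => f k t) N)
    (at_right 0) (Rbar_locally p_infty) (sum_n l N).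
Proof.
  intros Hf; induction N as [ | N IH].
  - rewrite sum_O; apply (is_RInt_pos_ext (V := C_R_NormedModule) (f 0%nat));
      [intros t _; rewrite sum_O; reflexivity | apply Hf].
  - rewrite sum_Sn.
    apply (is_RInt_pos_ext (V := C_R_NormedModule)
             (fun t => plus (G := C_R_NormedModule) (sum_n (fun k => f k t) N) (f (S N) t)));
      [intros t _; rewrite sum_Sn; reflexivity | ].
    exact (is_RInt_gen_plus (V := C_R_NormedModule) _ _ _ _ IH (Hf (S N))).
Qed.

Lemma exp_opp_pow (t : R) (k : nat) : exp (- t) ^ k = exp (- (INR k * t)).
Proof.
  induction k as [ | k IH]; [simpl; rewrite Rmult_0_l, Ropp_0, exp_0; reflexivity | ].
  simpl pow; rewrite IH, <- exp_plus, S_INR; f_equal; ring.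
Qed.

(** The [+ 1] in the rates [j + k + 1] is the factor [exp (- t)] of the kernel; [j] comes from [p^j]
    and [k] from the binomial formula. *)
Lemma binom_weight_expand (i j : nat) (t : R) : (j <= i)%nat ->
  exp (- t) * binom_weight (exp (- t)) i j
  = Binomial.C i j * sum_n (fun k => (-1) ^ k * Binomial.C (i - j) k
                              * exp (- (INR (j + k + 1) * t))) (i - j).
Proof.
  intros Hj; rewrite binom_weight_closed by exact Hj.
  replace (1 - exp (- t)) with (- exp (- t) + 1) by ring.
  rewrite binomial, <- sum_n_Reals.
  replace (exp (- t) * _) with (Binomial.C i j * (exp (- t) ^ (j + 1) *
    sum_n (fun k => Binomial.C (i - j) k * (- exp (- t)) ^ k * 1 ^ (i - j - k)) (i - j)))
    by (rewrite pow_add; ring).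
  f_equal; rewrite <- sum_n_Rmult; apply sum_n_ext; intros k.
  replace (- exp (- t)) with (-1 * exp (- t)) by ring.
  rewrite <- exp_opp_pow, pow1, Rpow_mult_distr.
  replace (j + k + 1)%nat with (j + 1 + k)%nat by lia.
  rewrite (pow_add _ (j + 1) k); ring_in R.
Qed.

Lemma RtoC_sum_n (a : nat -> R) (N : nat) :
  RtoC (sum_n a N) = sum_n (fun k => RtoC (a k)) N.
Proof.
  induction N as [ | N IH]; [rewrite !sum_O; reflexivity | ].
  rewrite sum_n_RS, RtoC_plus, IH, (sum_Sn (G := C_AbelianMonoid)); reflexivity.
Qed.

Theorem theorem3p1 (beta : C) (hbeta : 0 < Re beta) (i j : nat) :
  matrix_entry (Cesaro_pow beta) i j =
  if (i <? j)%nat then RtoC 0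
  else (RtoC (Binomial.C i j)
        * sum_n (fun k : nat =>
                   RtoC ((-1) ^ k) * RtoC (Binomial.C (i - j) k)
                   * Rcpow (INR (j + k + 1)) (- beta)) (i - j))%C.
Proof.
  rewrite matrix_entry_coef.
  change (coef (Cesaro_pow beta (H2_monomial j)) i)
    with (/ Cgamma beta * coef (RInt_gen (V := H2_CompleteNormedModule)
       (Cesaro_integrand beta j) (at_right 0) (Rbar_locally p_infty)) i)%C.
  assert (HG := Cgamma_neq_0 beta hbeta).
  assert (HI : is_RInt_gen (V := C_R_NormedModule)
    (fun t => gamma_kernel beta t * RtoC (binom_weight (exp (- t)) i j))%C
    (at_right 0) (Rbar_locally p_infty)
    (coef (RInt_gen (V := H2_CompleteNormedModule) (Cesaro_integrand beta j)
             (at_right 0) (Rbar_locally p_infty)) i)).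
  { apply (is_RInt_pos_ext (V := C_R_NormedModule)
             (fun t => coef (Cesaro_integrand beta j t) i)).
    { intros t Ht; apply coef_Cesaro_integrand; lra. }
    apply (is_RInt_gen_linear (U := H2_NormedModule) (V := C_R_NormedModule)
             (fun f : H2 => coef f i) _ _ _ _ _ _ (is_linear_coef i)).
    apply (RInt_gen_correct (V := H2_CompleteNormedModule)).
    apply (ex_RInt_pos_gamma (V := H2_CompleteNormedModule) _ (Re beta) hbeta).
    - intros t; apply continuous_Cesaro_integrand.
    - intros t; apply norm_Cesaro_integrand. }
  set (c := coef _ i) in *.
  assert (Huniq : forall l, is_RInt_gen (V := C_R_NormedModule)
    (fun t => gamma_kernel beta t * RtoC (binom_weight (exp (- t)) i j))%C
    (at_right 0) (Rbar_locally p_infty) l -> c = l).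
  { intros l Hl.
    rewrite <- (is_RInt_gen_unique (V := C_R_CompleteNormedModule) _ _ HI).
    exact (is_RInt_gen_unique (V := C_R_CompleteNormedModule) _ _ Hl). }
  destruct (Nat.ltb_spec i j) as [Hij | Hij].
  (* Above the diagonal the weight vanishes; writing the zero integrand as 0 times the kernel gives
     its integral by linearity. *)
  - rewrite (Huniq (RtoC 0 * Cgamma beta)%C); [ring | ].
    generalize (is_RInt_gen_linear (U := C_R_NormedModule) (V := C_R_NormedModule)
      _ _ _ _ _ _ _ (is_linear_Cmult (RtoC 0)) (is_RInt_pos_Cgamma beta hbeta)).
    apply (is_RInt_pos_ext (V := C_R_NormedModule)); intros t _.
    rewrite binom_weight_gt by exact Hij; apply Cmult_comm.
  - set (m := fun k => INR (j + k + 1)).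
    assert (Hm : forall k, 0 < m k) by (intros k; apply lt_0_INR; lia).
    set (b := fun k => (RtoC ((-1) ^ k) * RtoC (Binomial.C (i - j) k))%C).
    assert (Hsum := is_RInt_gen_linear (U := C_R_NormedModule) (V := C_R_NormedModule)
      _ _ _ _ _ _ _ (is_linear_Cmult (RtoC (Binomial.C i j)))
      (is_RInt_pos_sum_n _ _ (i - j) (fun k =>
        is_RInt_gen_linear (U := C_R_NormedModule) (V := C_R_NormedModule)
          _ _ _ _ _ _ _ (is_linear_Cmult (b k))
          (is_RInt_pos_gamma_rate beta (m k) hbeta (Hm k))))).
    apply (is_RInt_pos_ext (V := C_R_NormedModule) _
      (fun t => gamma_kernel beta t * RtoC (binom_weight (exp (- t)) i j))%C) in Hsum.
    + rewrite (Huniq _ Hsum).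
      (* Each term of the sum carries the same factor [Cgamma beta], brought out in front so that
         [HG] cancels it. *)
      transitivity (/ Cgamma beta * (RtoC (Binomial.C i j) *
        (Cgamma beta * sum_n (fun k => b k * Rcpow (m k) (- beta)) (i - j))))%C.
      * do 2 f_equal; rewrite <- Csum_n_mult_l; apply Csum_n_ext; intros k; ring.
      * unfold b, m; field; exact HG.
    + intros t _.
      transitivity (Rcpow t (beta - 1) * RtoC (exp (- t) * binom_weight (exp (- t)) i j))%C.
      2:{ unfold gamma_kernel; rewrite RtoC_mult; ring_in C. }
      rewrite binom_weight_expand, RtoC_mult, RtoC_sum_n by exact Hij.
      transitivity (RtoC (Binomial.C i j) * (Rcpow t (beta - 1) *
        sum_n (fun k => RtoC ((-1) ^ k * Binomial.C (i - j) k
                              * exp (- (INR (j + k + 1) * t)))) (i - j)))%C;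
        [ | ring_in C].
      apply (f_equal (Cmult (RtoC (Binomial.C i j)))); rewrite <- Csum_n_mult_l.
      apply Csum_n_ext; intros k; rewrite !RtoC_mult; unfold b, m; ring.
Qed.
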